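(* Let $1<p<\infty$. Then: (i) $W_0^{1,p}(\mathbb{R}_+,t^{p-1})=W^{1,p}(\mathbb{R}_+,t^{p-1})$. (ii) $Y^{1,p}_{t^{p-1}}\subsetneq W^{1,p}(\mathbb{R}_+,t^{p-1})$. (iii) The trace operator $Tr^0(u):=\lim_{t\to0}u(t)$ is not well defined on $W^{1,p}(\mathbb{R}_+,t^{p-1})$ (that is, it is not true that for every $u\in W^{1,p}(\mathbb{R}_+,t^{p-1})$ this limit exists as a finite real number). (iv) $W^{1,p}(\mathbb{R}_+,t^{p-1})=\mathcal{A}^\infty_{p,t^{p-1}}=\mathcal{B}^\infty_{p,t^{p-1}}$.
   Context: $\mathbb{R}_+=(0,\infty)$; functions are real valued. For $1\le p<\infty$ and $\beta\in\mathbb{R}$: $W^{1,p}(\mathbb{R}_+,t^\beta)$ is the Banach space of all $u\in W^{1,1}_{loc}(\mathbb{R}_+)$ with finite norm $$\|u\|_{W^{1,p}(\mathbb{R}_+,t^\beta)}=\Big(\int_{\mathbb{R}_+}|u(t)|^pt^\beta dt\Big)^{1/p}+\Big(\int_{\mathbb{R}_+}|u'(t)|^pt^\beta dt\Big)^{1/p}.$$ $Y^{1,p}_{t^\beta}$ is the Banach space of all $u\in W^{1,1}_{loc}(\mathbb{R}_+)$ with finite norm $$\|u\|_{Y^{1,p}_{t^\beta}}=\Big(\int_{\mathbb{R}_+}|u(t)|^pt^\beta\big(1+\tfrac{1}{t^p}\big)dt\Big)^{1/p}+\Big(\int_{\mathbb{R}_+}|u'(t)|^pt^\beta dt\Big)^{1/p}.$$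 Elements of $W^{1,1}_{loc}(\mathbb{R}_+)$ are identified with their continuous representatives on $\mathbb{R}_+$. $W_0^{1,p}(\mathbb{R}_+,t^\beta)$ denotes the completion (closure) of $C_0^\infty(\mathbb{R}_+)$, the smooth functions with compact support in $(0,\infty)$, in $W^{1,p}(\mathbb{R}_+,t^\beta)$. All of these are used with $\beta=p-1$. Define the sets $$\mathcal{A}^\infty_{p,t^\beta}=\{u\in W^{1,p}(\mathbb{R}_+,t^\beta):\ \text{there exists } t_n\nearrow\infty \text{ with } \lim_{n\to\infty}u(t_n)=0\},$$ $$\mathcal{B}^\infty_{p,t^\beta}=\{u\in W^{1,p}(\mathbb{R}_+,t^\beta):\ \lim_{t\to\infty}u(t)=0\}.$$ All equalities and inclusions between spaces are as sets of functions. *)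

(* Defs.v *)
From HB Require Import structures.
From mathcomp Require Import all_boot all_order all_algebra.
From mathcomp Require Import all_classical all_reals all_analysis.

Set Implicit Arguments.
Unset Strict Implicit.
Unset Printing Implicit Defensive.

Import Order.TTheory GRing.Theory Num.Theory.
Import numFieldNormedType.Exports.

Local Open Scope classical_set_scope.
Local Open Scope ring_scope.

(* A function on the half-line (0, +oo) is represented by a total function
   R -> R whose values outside (0, +oo) are irrelevant: apart from the notions
   defining test functions, everything below depends only on the restriction
   to (0, +oo).  A test function is a smooth function on (0, +oo) with compact
   support there, extended by zero. *)
Definition half_line {R : realType} : set R := `]0, +oo[.

Definition smooth {R : realType} (f : R -> R) : Prop :=
  forall (n : nat) (x : R), derivable (derive1n n f) x 1.

Definition supp {R : realType} (f : R -> R) : set R :=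
  closure [set x | f x != 0].

Definition test_function {R : realType} (f : R -> R) : Prop :=
  [/\ smooth f, compact (supp f) & supp f `<=` half_line].

Definition weak_derivative {R : realType} (u v : R -> R) : Prop :=
  locally_integrable half_line v /\
  forall phi : R -> R, test_function phi ->
    (\int[lebesgue_measure]_(t in half_line) (u t * derive1 phi t)%:E
     = - \int[lebesgue_measure]_(t in half_line) (v t * phi t)%:E)%E.

(* Members are the continuous representatives of the Sobolev classes. *)
Definition W11loc {R : realType} : set (R -> R) :=
  [set u | [/\ {within half_line, continuous u},
               locally_integrable half_line u &
               exists v, weak_derivative u v]].

(* A weak derivative is unique only almost everywhere; [wderiv u] is a chosen
   one, and an arbitrary function when u has none.  It is only used under
   integrals. *)
Definition wderiv {R : realType} (u : R -> R) : R -> R :=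
  xget (cst 0) [set v | weak_derivative u v].

Definition weighted_norm {R : realType} (p : R) (w f : R -> R) : \bar R :=
  ((\int[lebesgue_measure]_(t in half_line) (`|f t| `^ p * w t)%:E) `^ p^-1)%E.

Definition W1p_norm {R : realType} (p beta : R) (u : R -> R) : \bar R :=
  (weighted_norm p (fun t => t `^ beta)%R u +
   weighted_norm p (fun t => t `^ beta)%R (wderiv u))%E.

Definition Y1p_norm {R : realType} (p beta : R) (u : R -> R) : \bar R :=
  (weighted_norm p (fun t => t `^ beta * (1 + 1 / t `^ p))%R u +
   weighted_norm p (fun t => t `^ beta)%R (wderiv u))%E.

Definition W1p {R : realType} (p beta : R) : set (R -> R) :=
  [set u | W11loc u /\ (W1p_norm p beta u < +oo)%E].

Definition Y1p {R : realType} (p beta : R) : set (R -> R) :=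
  [set u | W11loc u /\ (Y1p_norm p beta u < +oo)%E].

Definition W1p0 {R : realType} (p beta : R) : set (R -> R) :=
  [set u | W1p p beta u /\
     forall e : R, 0 < e -> exists2 phi : R -> R, test_function phi &
       (W1p_norm p beta (u \- phi)%R < e%:E)%E].

Definition Ainfty {R : realType} (p beta : R) : set (R -> R) :=
  [set u | W1p p beta u /\
     exists t : R^nat, [/\ forall n, half_line (t n), nondecreasing_seq t,
       t @ \oo --> +oo & (u \o t) @ \oo --> 0]].

Definition Binfty {R : realType} (p beta : R) : set (R -> R) :=
  [set u | W1p p beta u /\ u t @[t --> +oo] --> 0].

(* Main.v *)
Require Import Defs.
From mathcomp Require Import all_boot all_order all_algebra.
From mathcomp Require Import all_classical all_reals all_analysis.
From mathcomp Require Import measurable_realfun.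
From mathcomp Require Import ring lra.
Import Order.TTheory GRing.Theory Num.Theory.
Import numFieldNormedType.Exports.
Local Open Scope classical_set_scope.
Local Open Scope ring_scope.

(** The substitution t = exp (- x) turns the integral of |u'|^p t^(p-1) into the
    integral of |w'|^p without weight, with w x = u (exp (- x)).  The weight is
    thus the scale-invariant one, and three consequences of this carry the
    proof.

    Members of the space satisfy the fundamental theorem of calculus
    ([weak_derivative_ftc], obtained by testing against smoothed indicators of
    intervals), so a weak derivative is determined almost everywhere and may be
    computed by hand.

    Limits at infinity.  The integral of |u|^p t^(p-1) over [t/2, t] tends to 0,
    so u is small somewhere in that window ([energy_pick]), even after multiplication
    by t; the oscillation of u over the window is bounded by the energy of u'
    there, uniformly in t because of scale invariance
    ([integral_norm_energy]).  Hence u tends to 0 at infinity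
    ([cvg_infty_of_energy]).

    Density of test functions.  The end point 0 has zero capacity: a function
    rising from 0 to 1 in n equal steps, one in each of n consecutive dyadic
    intervals, has energy of order n^(1-p), because the n derivatives have
    disjoint supports ([zero_capacity]).  Choose s near 0 and T large such that
    |u s|^p s^p and |u T|^p T^p are small.  Replace u by the constant u s
    on ]0, s], cut off by such a function, and by a multiple of a descending
    ramp beyond T; on [s, T] integrate a smooth function close to u' in L^p
    ([smooth_energy_dense]).  The result is a test function close to u
    ([test_function_approximation]).

    Failure of the trace and strictness.  The function log (1 + log (1/t)) on
    ]0, 1], extended by 0, belongs to the space: the energy density of its derivative is
    1 / (t (1 + log (1/t))^p), which is integrable at 0 since p > 1
    ([energy_loglog_deriv]).  It is unbounded at 0, so it has no finite limit
    there, and it is not in Y since 1/t is not integrable at 0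
    ([loglog_notin_Y1p]). *)

Set Implicit Arguments.
Unset Strict Implicit.

(** * Smooth functions and a smooth transition *)

Section smooth.
Context {R : realType}.
Implicit Types f g : R -> R.

(** Smoothness is thereby reduced to one derivation at a time; P is taken to be
    a class closed under the rules of derivation. *)
Lemma smooth_coind (P : set (R -> R)) :
  (forall f, P f -> (forall x, derivable f x 1) /\ P (derive1 f)) ->
  forall f, P f -> smooth f.
Proof.
move=> H f Pf n.
suff : P (derive1n n f) by move=> /H[].
by elim: n => [//|n IH]; rewrite derive1nS; exact: (H _ IH).2.
Qed.

Lemma smooth_derivable f : smooth f -> forall x, derivable f x 1.
Proof. by move=> sf x; exact: (sf 0%N x). Qed.

Lemma smooth_derive1 f : smooth f -> smooth (derive1 f).
Proof. by move=> sf n x; rewrite -derive1Sn; exact: (sf n.+1 x). Qed.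

Lemma smooth_antiderivative f :
  (forall x, derivable f x 1) -> smooth (derive1 f) -> smooth f.
Proof. by move=> df sf [//|n] x; rewrite derive1Sn; exact: sf. Qed.

Lemma smooth_continuous f : smooth f -> continuous f.
Proof.
move=> sf x; apply: differentiable_continuous.
by apply/derivable1_diffP; exact: smooth_derivable.
Qed.

Lemma is_derive1_eq f (x a b : R) : is_derive x 1 f a -> a = b -> is_derive x 1 f b.
Proof. by move=> ? <-. Qed.

(** The power of 1/x is a parameter since derivation of exp (-1/x) produces
    such factors; the family is stable under derivation up to linear
    combinations. *)
Definition flat (k : nat) (x : R) : R :=
  if 0 < x then x^-1 ^+ k * expR (- x^-1) else 0.

(** The difference quotient of [flat k] at 0 is [flat k.+1], so a bound that
    vanishes at 0, for every k, settles derivability there.  It comes from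
    exp y >= y^(k+1) / (k+1)! at y = 1/x. *)
Lemma flat_bound k x : 0 < x -> flat k x <= (k.+1)`!%:R * x.
Proof.
move=> x0; rewrite /flat x0.
have xV : 0 < x^-1 by rewrite invr_gt0.
have := expR_ge1Dxn k (ltW xV).
have fk : 0 < (k.+1)`!%:R :> R by rewrite ltr0n fact_gt0.
move=> h.
have h1 : x^-1 ^+ k.+1 <= (k.+1)`!%:R * expR x^-1.
  rewrite mulrC -ler_pdivrMr//; apply: le_trans h; lra.
rewrite expRN -ler_pdivlMr ?invr_gt0 ?expR_gt0// invrK.
rewrite -[leLHS](mulfVK (lt0r_neq0 x0)).
by rewrite -exprSr mulrAC ler_wpM2r// ltW.
Qed.

Lemma flat_ge0 k x : 0 <= flat k x.
Proof.
rewrite /flat; case: ifPn => // x0.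
by rewrite mulr_ge0// ?expR_ge0// exprn_ge0// invr_ge0 ltW.
Qed.

Lemma is_derive_flat k (x : R) :
  is_derive x 1 (flat k) (flat k.+2 x - k%:R * flat k.+1 x).
Proof.
have [x0|x0|<-] := ltgtP 0 x.
- have nf : {near x, flat k =1 fun y => y^-1 ^+ k * expR (- y^-1)}.
    by near=> y; rewrite /flat ifT//; near: y; exact: lt_nbhsr.
  apply: (@near_eq_is_derive R R^o R^o (fun y => y^-1 ^+ k * expR (- y^-1))).
    by near=> y; apply/esym; near: y; exact: nf.
  have xn : x != 0 by rewrite gt_eqF.
  have dV : is_derive x 1 (fun y : R => y^-1) (- x ^- 2).
    have h := @is_deriveV R id x 1 1 xn (is_derive_id x 1).
    by apply: (is_derive1_eq h); rewrite scaler1.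
  have -> : flat k.+2 x - k%:R * flat k.+1 x =
     (x^-1 ^+ k) *: (expR (- x^-1) * x^-2) + expR (- x^-1) *: ((k%:R * x^-1 ^+ k.-1) *: (- x ^-2)).
    rewrite /flat x0 /GRing.scale /=.
    case: k nf => [|k] _.
      rewrite expr0 !mul0r mulr0 subr0. by field.
    rewrite /= -!exprVn !exprS expr0; move: (x^-1) (x^-1 ^+ k) (k.+1%:R : R) (expR _) => y z c E.
    by ring.
  have d1 : is_derive x 1 (fun y : R => y^-1 ^+ k) ((k%:R * x^-1 ^+ k.-1) *: (- x ^-2)).
    by have := is_deriveX k dV; rewrite exprfctE.
  have d2 : is_derive x 1 (fun y : R => expR (- y^-1)) (expR (- x^-1) * x^-2).
    have := @is_derive1_comp R expR (fun y => - y^-1) x _ _.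
    move=> /(_ _ _ (is_derive_expR _) (is_deriveN dV)).
    by rewrite opprK.
  exact: is_deriveM.
- have nf : {near x, cst 0 =1 flat k}.
    near=> y; rewrite /flat ifF//; apply/negbTE; rewrite -leNgt.
    near: y; exact: lt_le_nbhsl.
  have -> : flat k.+2 x - k%:R * flat k.+1 x = 0.
    by rewrite /flat ltNge (ltW x0) /= mulr0 subr0.
  exact: (@near_eq_is_derive R R^o R^o (cst 0)).
- have -> : flat k.+2 0 - k%:R * flat k.+1 0 = 0 :> R.
    by rewrite /flat ltxx mulr0 subr0.
  suff h : h^-1 *: (flat k (h *: 1 + 0) - flat k 0) @[h --> (0:R)^'] --> (0 : R).
    apply: DeriveDef; first by apply/cvg_ex; exists 0.
    exact: cvg_lim h.
  apply/cvgr0Pnorm_le => e e0.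
  have C0 : 0 < (k.+2)`!%:R :> R by rewrite ltr0n fact_gt0.
  have : \forall h \near (0:R)^', `|h| < e / (k.+2)`!%:R.
    by apply: dnbhs0_lt; rewrite divr_gt0.
  apply: filterS => h; rewrite ltr_pdivlMr// => he.
  rewrite /GRing.scale/= mulr1 addr0 [flat k 0]/flat ltxx subr0.
  have [h0|h0] := ltP 0 h; last by rewrite /flat ltNge h0 mulr0 normr0 ltW.
  have -> : h^-1 * flat k h = flat k.+1 h by rewrite /flat h0 exprS mulrA.
  rewrite ger0_norm ?flat_ge0//; apply: le_trans (flat_bound _ h0) _.
  by rewrite mulrC; apply/ltW; rewrite -(gtr0_norm h0).
Unshelve. all: by end_near. Qed.

(** The closure under derivation of the smooth functions and the [flat k]. *)
Inductive smooth_expr : set (R -> R) :=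
| smooth_exprB f : smooth f -> smooth_expr f
| smooth_exprF k : smooth_expr (flat k)
| smooth_exprC c : smooth_expr (cst c)
| smooth_expr1 : smooth_expr id
| smooth_exprD f g : smooth_expr f -> smooth_expr g -> smooth_expr (f \+ g)
| smooth_exprM f g : smooth_expr f -> smooth_expr g -> smooth_expr (f \* g)
| smooth_exprV f : (forall x, f x != 0) -> smooth_expr f ->
    smooth_expr (fun x => (f x)^-1)
| smooth_exprK f g : smooth_expr f -> smooth_expr g -> smooth_expr (f \o g).

Lemma smooth_expr_smooth f : smooth_expr f -> smooth f.
Proof.
apply: smooth_coind => {}f.
suff : smooth_expr f -> exists2 g, smooth_expr g & forall x : R, is_derive x 1 f (g x).
  move=> H /H[g eg dg]; split=> [x|]; first by have [] := dg x.
  suff -> : derive1 f = g by [].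
  by apply/funext => x; rewrite derive1E; have [] := dg x.
elim=> {f}.
- move=> f sf; exists (derive1 f); first exact/smooth_exprB/smooth_derive1.
  by move=> x; rewrite derive1E; apply/derivableP; exact: smooth_derivable.
- move=> k; exists (flat k.+2 \+ cst (- k%:R) \* flat k.+1).
    apply: smooth_exprD; first exact: smooth_exprF.
    by apply: smooth_exprM; [exact: smooth_exprC|exact: smooth_exprF].
  by move=> x; rewrite /= mulNr; exact: is_derive_flat.
- by move=> c; exists (cst 0); [exact: smooth_exprC|move=> x; exact: is_derive_cst].
- by exists (cst 1); [exact: smooth_exprC|move=> x; exact: is_derive_id].
- move=> f g _ [f' ef df] _ [g' eg dg]; exists (f' \+ g'); first exact: smooth_exprD.
  by move=> x; exact: is_deriveD.
- move=> f g sf [f' ef df] sg [g' eg dg]; exists ((f \* g') \+ (g \* f')).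
    by apply: smooth_exprD; exact: smooth_exprM.
  by move=> x; exact: is_deriveM.
- move=> f f0 sf [f' ef df].
  exists (cst (- 1) \* ((fun x => (f x)^-1) \* (fun x => (f x)^-1) \* f')).
    apply: smooth_exprM; first exact: smooth_exprC.
    by do 2! (apply: smooth_exprM => //); exact: smooth_exprV.
  move=> x; apply: (is_derive1_eq (is_deriveV (f0 x) (df x))).
  by rewrite /GRing.scale/= mulN1r mulNr expr2 invfM.
- move=> f g sf [f' ef df] sg [g' eg dg]; exists ((f' \o g) \* g').
    by apply: smooth_exprM => //; exact: smooth_exprK.
  by move=> x; exact: is_derive1_comp.
Qed.

Lemma smooth_cst c : smooth (cst c : R -> R).
Proof. exact/smooth_expr_smooth/smooth_exprC. Qed.

Lemma smoothD f g : smooth f -> smooth g -> smooth (f \+ g).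
Proof.
by move=> sf sg; apply/smooth_expr_smooth/smooth_exprD; exact: smooth_exprB.
Qed.

Lemma smoothM f g : smooth f -> smooth g -> smooth (f \* g).
Proof.
by move=> sf sg; apply/smooth_expr_smooth/smooth_exprM; exact: smooth_exprB.
Qed.

Lemma smooth_comp_affine f a b : smooth f -> smooth (fun x => f (a * x + b)).
Proof.
move=> sf; apply/smooth_expr_smooth.
apply: (@smooth_exprK f (cst a \* id \+ cst b)); first exact: smooth_exprB.
apply: smooth_exprD; last exact: smooth_exprC.
by apply: smooth_exprM; [exact: smooth_exprC|exact: smooth_expr1].
Qed.

Lemma derive1_comp_affine f a b x : smooth f ->
  derive1 (fun x => f (a * x + b)) x = a * derive1 f (a * x + b).
Proof.
move=> sf; rewrite derive1E.
have df : is_derive (a * x + b) 1 f (derive1 f (a * x + b)).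
  by rewrite derive1E; apply/derivableP; exact: smooth_derivable.
have dg : is_derive x 1 (fun x : R => a * x + b) a.
  have h := is_deriveD (is_deriveM (is_derive_cst a x 1) (is_derive_id x 1)) (is_derive_cst b x 1).
  apply: (is_derive1_eq h).
  by rewrite /GRing.scale/= mulr0 addr0 addr0 mulr1.
by have [_ ->] := @is_derive1_comp _ f _ x _ _ df dg; rewrite mulrC.
Qed.

Lemma derive1D_smooth f g : smooth f -> smooth g ->
  derive1 (f \+ g) = derive1 f \+ derive1 g.
Proof.
move=> sf sg; apply/funext => x; rewrite /= !derive1E.
by rewrite (@deriveD _ _ _ f g)//; exact: smooth_derivable.
Qed.

Lemma derive1M_smooth f g : smooth f -> smooth g ->
  derive1 (f \* g) = (f \* derive1 g) \+ (g \* derive1 f).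
Proof.
move=> sf sg; apply/funext => x; rewrite /= !derive1E.
by rewrite (@deriveM _ _ f g)//; exact: smooth_derivable.
Qed.

Lemma derive1Z_smooth (k : R) f : smooth f ->
  derive1 (cst k \* f) = cst k \* derive1 f.
Proof.
move=> sf; have sc : smooth (cst k : R -> R) by exact: smooth_cst.
rewrite (derive1M_smooth sc sf).
by apply/funext => x /=; rewrite derive1_cst mulr0 addr0.
Qed.

Lemma derive1_near_cst f c (x : R) : (\forall y \near x, f y = c) -> derive1 f x = 0.
Proof.
move=> fc; rewrite derive1E (@near_eq_derive R R^o R^o f (cst c))//.
by rewrite derive_cst.
Qed.

(** The classical smooth transition from 0 to 1 over [0, 1]. *)
Definition smooth_step (x : R) : R := flat 0 x / (flat 0 x + flat 0 (1 - x)).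

Lemma smooth_step_den_gt0 x : 0 < flat 0 x + flat 0 (1 - x).
Proof.
have [x0|x0] := ltP 0 x.
  by rewrite ltr_pwDl ?flat_ge0// /flat x0 expr0 mul1r expR_gt0.
by rewrite ltr_wpDl ?flat_ge0// /flat ifT ?expr0 ?mul1r ?expR_gt0//; lra.
Qed.

Lemma smooth_smooth_step : smooth smooth_step.
Proof.
apply/smooth_expr_smooth.
have e1 : smooth_expr (fun x : R => flat 0 (1 - x)).
  rewrite (_ : (fun x => _) = flat 0 \o (cst 1 \+ (cst (-1) \* id))); last first.
    by apply/funext => x /=; rewrite mulN1r.
  apply: smooth_exprK; first exact: smooth_exprF.
  apply: smooth_exprD; first exact: smooth_exprC.
  by apply: smooth_exprM; [exact: smooth_exprC|exact: smooth_expr1].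
apply: (@smooth_exprM (flat 0)); first exact: smooth_exprF.
apply: (@smooth_exprV (flat 0 \+ (fun x : R => flat 0 (1 - x)))).
  by move=> x; rewrite gt_eqF// smooth_step_den_gt0.
by apply: smooth_exprD => //; exact: smooth_exprF.
Qed.

Lemma smooth_step0 x : x <= 0 -> smooth_step x = 0.
Proof. by move=> x0; rewrite /smooth_step /flat ltNge x0 /= mul0r. Qed.

Lemma smooth_step1 x : 1 <= x -> smooth_step x = 1.
Proof.
move=> x1; have := smooth_step_den_gt0 x; rewrite /smooth_step.
have -> : flat 0 (1 - x) = 0 by rewrite /flat ifF//; apply/negbTE; rewrite -leNgt; lra.
by rewrite addr0 => x0; rewrite divff// gt_eqF.
Qed.

Lemma smooth_step_itv x : 0 <= smooth_step x <= 1.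
Proof.
have d0 := smooth_step_den_gt0 x.
rewrite divr_ge0 ?flat_ge0 ?(ltW d0)//=.
by rewrite ler_pdivrMr// mul1r lerDl flat_ge0.
Qed.

(** Such points are global extrema of the step. *)
Lemma derive1_smooth_step_out x : (x <= 0) || (1 <= x) -> derive1 smooth_step x = 0.
Proof.
have x1 : x - 1 <= x + 1 by lra.
have xI : x \in `](x - 1), (x + 1)[ by rewrite in_itv/=; apply/andP; split; lra.
have dS y : y \in `](x - 1), (x + 1)[ -> derivable smooth_step y 1.
  by move=> _; exact/smooth_derivable/smooth_smooth_step.
rewrite derive1E => /orP[x0|x0].
  apply: derive_val; apply: (derive1_at_min x1 dS xI) => t _.
  by rewrite (smooth_step0 x0); have /andP[] := smooth_step_itv t.
apply: derive_val; apply: (derive1_at_max x1 dS xI) => t _.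
by rewrite (smooth_step1 x0); have /andP[] := smooth_step_itv t.
Qed.

Lemma derive1_smooth_step_bounded : exists2 C, 0 < C &
  forall x, `|derive1 smooth_step x| <= C.
Proof.
have cS := smooth_continuous (smooth_derive1 smooth_smooth_step).
have [|c _ cM] := @EVT_max R (fun x => `|derive1 smooth_step x|) 0 1 ler01 _.
  by apply: continuous_subspaceT => x; apply: cvg_norm; exact: cS.
exists (`|derive1 smooth_step c| + 1); first by rewrite ltr_wpDl.
move=> x; have [/andP[x0 x1]|] := boolP (0 <= x <= 1).
  by rewrite (le_trans (cM x _)) ?in_itv/= ?x0// lerDl.
rewrite negb_and -!ltNge => /orP x01.
rewrite derive1_smooth_step_out ?normr0 ?addr_ge0//.
by case: x01 => /ltW ->; rewrite ?orbT.
Qed.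

End smooth.

(** * Integration with respect to Lebesgue measure *)

(** The [lebesgue_] lemmas are instances of general ones in which the
    measure, and with it the measurable structure on R, is fixed. *)

Section lebesgue.
Context {R : realType}.
Local Notation mu := (@lebesgue_measure R).
Implicit Types f g : R -> R.

(** Both sides are integrals over R of the same function. *)
Lemma integral_support (A B : set R) (f : R -> \bar R) : A `<=` B ->
  (forall x, B x -> ~ A x -> f x = 0%E) ->
  (\int[mu]_(x in B) f x = \int[mu]_(x in A) f x)%E.
Proof.
move=> AB f0; rewrite integral_mkcond [RHS]integral_mkcond.
congr (integral _ _ _); apply/funext => x; rewrite !patchE.
case: ifPn => [|] xB; case: ifPn => [|] xA //.
- by apply: f0; [exact: set_mem xB|move=> /mem_set; rewrite (negbTE xA)].
- by exfalso; move: xB => /negP; apply; exact/mem_set/AB/set_mem.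
Qed.

Lemma lebesgue_integrableZ (D : set R) k f : measurable D ->
  mu.-integrable D (fun x => (f x)%:E) -> mu.-integrable D (fun x => (k * f x)%:E).
Proof. by move=> mD If; exact: (integrableZl _ k If). Qed.

Lemma lebesgue_integrableD (D : set R) f g : measurable D ->
  mu.-integrable D (fun x => (f x)%:E) -> mu.-integrable D (fun x => (g x)%:E) ->
  mu.-integrable D (fun x => (f x + g x)%:E).
Proof. by move=> mD If Ig; exact: (integrableD _ If Ig). Qed.

Lemma lebesgue_integrableB (D : set R) f g : measurable D ->
  mu.-integrable D (fun x => (f x)%:E) -> mu.-integrable D (fun x => (g x)%:E) ->
  mu.-integrable D (fun x => (f x - g x)%:E).
Proof. by move=> mD If Ig; exact: (integrableB _ If Ig). Qed.

Lemma lebesgue_fin_num_integrable (D : set R) f : measurable D ->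
  measurable_fun D f -> (\int[mu]_(x in D) (f x)%:E)%E \is a fin_num ->
  mu.-integrable D (fun x => (f x)%:E).
Proof.
move=> mD mf Ef; apply/integrableP; split; first exact/measurable_EFinP.
by have := integral_fin_num_abs mu mD mf; rewrite Ef.
Qed.

Lemma lebesgue_ge0_le_integral (D : set R) f g : measurable D ->
  (forall x, D x -> 0 <= f x) ->
  measurable_fun D f -> measurable_fun D g ->
  (forall x, D x -> f x <= g x) ->
  (\int[mu]_(x in D) (f x)%:E <= \int[mu]_(x in D) (g x)%:E)%E.
Proof.
move=> mD f0 mf mg fg; apply: ge0_le_integral => //.
- exact/measurable_EFinP.
- exact/measurable_EFinP.
Qed.

Lemma lebesgue_ge0_subset_integral (A B : set R) f : measurable A -> measurable B ->
  measurable_fun B f -> (forall x, B x -> 0 <= f x) -> A `<=` B ->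
  (\int[mu]_(x in A) (f x)%:E <= \int[mu]_(x in B) (f x)%:E)%E.
Proof.
move=> mA mB mf f0 AB; apply: ge0_subset_integral => //.
- exact/measurable_EFinP.
Qed.

Lemma lebesgue_dominated_cvg (D : set R) (f_ : nat -> R -> \bar R) (f g : R -> \bar R) :
  measurable D -> (forall n, measurable_fun D (f_ n)) -> measurable_fun D f ->
  {ae mu, forall x, D x -> f_ ^~ x @ \oo --> f x} ->
  mu.-integrable D g ->
  {ae mu, forall x, forall n, D x -> (`|f_ n x| <= g x)%E} ->
  (\int[mu]_(x in D) f_ n x)%E @[n --> \oo] --> (\int[mu]_(x in D) f x)%E.
Proof.
move=> mD mf_ mf cvf ig dom.
by have [] := @dominated_convergence _ _ _ mu D mD f_ f g mf_ mf cvf ig dom.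
Qed.

Lemma lebesgue_aeS (P Q : R -> Prop) : (forall x, P x -> Q x) ->
  {ae mu, forall x, P x} -> {ae mu, forall x, Q x}.
Proof. by move=> PQ; apply: filterS => //; exact: (ae_filter_ringOfSetsType mu). Qed.

Lemma lebesgue_measure_segment (a b : R) : a <= b -> mu `[a, b]%classic = (b - a)%:E.
Proof.
move=> ab; rewrite lebesgue_measure_itv/= lte_fin.
case: ltP => // ba; suff -> : a = b by rewrite subrr.
by apply/eqP; rewrite eq_le ab.
Qed.

Lemma integral_segment_cst (a b c : R) : a <= b ->
  (\int[mu]_(x in `[a, b]) c%:E)%E = (c * (b - a))%:E.
Proof.
move=> ab; rewrite (@integral_cst _ _ _ mu _ (measurable_itv _))//.
by rewrite EFinM; congr (_ * _)%E; exact: lebesgue_measure_segment.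
Qed.

Lemma Rintegral_segment_cst (a b c : R) : a <= b ->
  \int[mu]_(x in `[a, b]) c = c * (b - a).
Proof. by move=> ab; rewrite /Rintegral integral_segment_cst. Qed.

Lemma within_continuous_segment_integrable f (a b : R) :
  {within `[a, b], continuous f} -> mu.-integrable `[a, b] (EFin \o f).
Proof.
by move=> cf; apply: continuous_compact_integrable => //; exact: segment_compact.
Qed.

Lemma segment_continuousM f g (a b : R) :
  {within `[a, b], continuous f} -> {within `[a, b], continuous g} ->
  {within `[a, b], continuous (fun x => f x * g x)}.
Proof. by move=> cf cg x; apply: cvgM; [exact: cf|exact: cg]. Qed.

Lemma continuous_measurableS f (D : set R) : measurable D -> continuous f ->
  measurable_fun D f.
Proof. by move=> mD cf; apply: measurable_funTS; exact: continuous_measurable_fun. Qed.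

Lemma smooth_measurable (D : set R) f : measurable D -> smooth f -> measurable_fun D f.
Proof. by move=> mD sf; apply: continuous_measurableS => //; exact: smooth_continuous. Qed.

Lemma smooth_derivable_oo_LRcontinuous f (a b : R) : smooth f ->
  derivable_oo_LRcontinuous f a b.
Proof.
move=> sf; have cf := smooth_continuous sf; split.
- by move=> x _; exact: smooth_derivable.
- by apply: cvg_at_right_filter; exact: cf.
- by apply: cvg_at_left_filter; exact: cf.
Qed.

Lemma integral_derive1_smooth f (a b : R) : smooth f -> a < b ->
  (\int[mu]_(x in `[a, b]) (derive1 f x)%:E = (f b - f a)%:E)%E.
Proof.
move=> sf ab; rewrite (@continuous_FTC2 _ (derive1 f) f)//.
- by apply: continuous_subspaceT => x; exact/smooth_continuous/smooth_derive1.
- exact: smooth_derivable_oo_LRcontinuous.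
Qed.

Lemma smooth_eq0_derive1 f (a b : R) : smooth f -> a <= b ->
  (forall x, a <= x -> derive1 f x = 0) -> f b = f a.
Proof.
move=> sf ab f0; have [<-//|ab'] := eqVneq a b.
have {}ab : a < b by rewrite lt_neqAle ab'.
have := integral_derive1_smooth sf ab; rewrite integral0_eq.
  by move=> /eqP; rewrite eqe eq_sym subr_eq0 => /eqP.
by move=> x /=; rewrite in_itv/= => /andP[ax _]; rewrite f0.
Qed.

(** The vanishing of f before s allows the primitive to be defined on all of R
    by an integral over a bounded segment. *)
Lemma smooth_primitive f (s : R) : smooth f -> (forall x, x <= s -> f x = 0) ->
  exists F, [/\ smooth F, derive1 F = f & forall x, x <= s -> F x = 0].
Proof.
move=> sf f0; have cf := smooth_continuous sf.
(* starting the integral before s makes s an interior point *)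
pose F (x : R) := \int[mu]_(t in `[s - 1, x]) f t.
have F0 x : x <= s -> F x = 0.
  move=> xs; rewrite /F (eq_Rintegral _ (g := cst 0)).
    by rewrite /Rintegral integral0.
  by move=> t; rewrite inE/= in_itv/= => /andP[_ tx]; rewrite f0// (le_trans tx).
have dF (x : R) : derivable F x 1 /\ derive1 F x = f x.
  have [xs|sx] := ltP x s.
    have nF : \forall y \near x, 0 = F y.
      have : \forall y \near x, y < s by exact: lt_nbhsl.
      by apply: filterS => y /ltW/F0.
    have h : is_derive x 1 F 0.
      by apply: (@near_eq_is_derive R R^o R^o (cst 0) F) => //; exact: is_derive_cst.
    by split; [case: h|rewrite derive1E (f0 x (ltW xs)); case: h].
  apply: (@continuous_FTC1_closed R f (s - 1) x (x + 1)).
  - by rewrite ltrDl.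
  - apply: within_continuous_segment_integrable.
    by apply: continuous_subspaceT => y; exact: cf.
  - by rewrite ltrBlDr (le_lt_trans sx)// ltrDl.
  - exact: cf.
have dFf : derive1 F = f by apply/funext => x; exact: (dF x).2.
exists F; split; [|exact: dFf|exact: F0].
apply: smooth_antiderivative; last by rewrite dFf.
by move=> x; exact: (dF x).1.
Qed.

End lebesgue.

(** * The half-line and its test functions *)

Section half_line.
Context {R : realType}.
Local Notation mu := (@lebesgue_measure R).
Implicit Types f u v : R -> R.

Lemma half_lineE (x : R) : half_line x = (0 < x) :> Prop.
Proof. by rewrite /half_line/= in_itv/= andbT. Qed.

Lemma segment_half_line (a b : R) : 0 < a -> `[a, b] `<=` (half_line : set R).
Proof.
move=> a0 x; rewrite /half_line/= !in_itv/= andbT => /andP[ax _].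
exact: lt_le_trans ax.
Qed.

Lemma measurable_half_line : measurable (half_line : set R).
Proof. exact: measurable_itv. Qed.

Lemma measurable_sub_half_line (A : set R) v : A `<=` half_line ->
  measurable_fun half_line v -> measurable_fun A v.
Proof. by move=> AH mv; apply: measurable_funS mv => //; exact: measurable_half_line. Qed.

Lemma half_line_continuous f : (forall x, 0 < x -> {for x, continuous f}) ->
  {within half_line, continuous f}.
Proof.
move=> cf; rewrite continuous_open_subspace; last exact: interval_open.
by move=> x /set_mem; rewrite half_lineE; exact: cf.
Qed.

Lemma half_line_segment_continuous u (a b : R) : 0 < a ->
  {within half_line, continuous u} -> {within `[a, b], continuous u}.
Proof.
by move=> a0; apply: continuous_subspaceW; exact: segment_half_line.
Qed.

Lemma half_line_continuous_measurable u : {within half_line, continuous u} ->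
  measurable_fun half_line u.
Proof.
by move=> cu; apply: subspace_continuous_measurable_fun => //; exact: measurable_half_line.
Qed.

Lemma locally_integrable_measurable (D : set R) v :
  locally_integrable D v -> measurable_fun D v.
Proof. by case. Qed.

Lemma half_line_continuous_locally_integrable f : {within half_line, continuous f} ->
  locally_integrable half_line f.
Proof.
move=> cf; split; [exact: half_line_continuous_measurable|exact: interval_open|].
move=> K KH cK.
have /integrableP[_] : mu.-integrable K (EFin \o f).
  by apply: continuous_compact_integrable => //; exact: continuous_subspaceW cf.
by [].
Qed.

Lemma locally_integrable_segment v (a b : R) : 0 < a ->
  locally_integrable half_line v -> mu.-integrable `[a, b] (EFin \o v).
Proof.
move=> a0 [mv _ iv]; apply/integrableP; split.
  apply/measurable_EFinP; apply: measurable_funS mv.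
    exact: measurable_half_line.
  exact: segment_half_line.
by apply: iv; [exact: segment_half_line|exact: segment_compact].
Qed.

Lemma test_function_itv f (a b : R) : smooth f -> 0 < a ->
  (forall x, f x != 0 -> a <= x <= b) -> test_function f.
Proof.
move=> sf a0 fab.
have suppf : supp f `<=` `[a, b].
  have -> : `[a, b]%classic = closure (`[a, b]%classic : set R) by apply/closure_id; exact: itv_closed.
  by apply: closureS => x /fab; rewrite /= in_itv.
split => //.
  apply: subclosed_compact suppf; first exact: closed_closure.
  exact: segment_compact.
apply: subset_trans suppf _ => x; rewrite /half_line/= !in_itv/= andbT.
by move=> /andP[ax _]; exact: lt_le_trans ax.
Qed.

(** The segment is slightly larger than the support, for the derivative to
    vanish outside it too. *)
Lemma test_function_supp f : test_function f -> exists a b : R, [/\ 0 < a, a < b &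
  forall x, ~~ (a <= x <= b) -> f x = 0 /\ derive1 f x = 0].
Proof.
move=> [sf cf hf].
suff [a [b [a0 ab fab]]] : exists a b : R, [/\ 0 < a, a < b &
    forall x, f x != 0 -> a <= x <= b].
  exists (a / 2), (b + 1); split; [lra|lra|].
  move=> x xab.
  have fx : \forall y \near x, f y = 0.
    move: xab; rewrite negb_and -!ltNge => /orP[xa|bx].
    - have : \forall y \near x, y < a by apply: lt_nbhsl; lra.
      apply: filterS => y ya; apply/eqP/negPn/negP => /fab; lra.
    - have : \forall y \near x, b < y by apply: lt_nbhsr; lra.
      apply: filterS => y ya; apply/eqP/negPn/negP => /fab; lra.
  by split; [exact: (nbhs_singleton fx)|exact: derive1_near_cst fx].
have [f0|f0] := pselect (supp f !=set0); last first.
  exists 1, 2; split; [lra|lra|] => x fx; exfalso; apply: f0; exists x.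
  by apply: subset_closure.
have cid : {within supp f, continuous (@id R)} by apply: continuous_subspaceT => x; exact: cvg_id.
have [c cs cM] := compact_EVT_max f0 cf cid.
have [d ds dM] := compact_EVT_min f0 cf cid.
have d0 : 0 < d.
  by move: ds; rewrite inE => /hf; rewrite /half_line/= in_itv/= andbT.
have dc : d <= c by exact: dM.
exists d, (c + 1); split => //; first lra.
move=> x fx.
have xs : x \in supp f by rewrite inE; apply: subset_closure.
by rewrite dM//=; have /= := cM _ xs; lra.
Qed.

End half_line.

(** * Ramps and plateaus *)

Section ramps.
Context {R : realType}.
Implicit Types f : R -> R.

Definition ramp (c d x : R) : R := smooth_step (d^-1 * x + - (d^-1 * c)).

Lemma smooth_ramp c d : smooth (ramp c d).
Proof. exact/smooth_comp_affine/smooth_smooth_step. Qed.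

Lemma rampE c d x : ramp c d x = smooth_step ((x - c) / d).
Proof. by rewrite /ramp -mulrBr mulrC. Qed.

Lemma ramp0 c d x : 0 < d -> x <= c -> ramp c d x = 0.
Proof.
by move=> d0 xc; rewrite rampE smooth_step0// ler_pdivrMr// mul0r subr_le0.
Qed.

Lemma ramp1 c d x : 0 < d -> c + d <= x -> ramp c d x = 1.
Proof. by move=> d0 xc; rewrite rampE smooth_step1// ler_pdivlMr//; lra. Qed.

Lemma ramp_itv c d x : 0 <= ramp c d x <= 1.
Proof. exact: smooth_step_itv. Qed.

Lemma derive1_ramp_out c d x : 0 < d -> (x <= c) || (c + d <= x) ->
  derive1 (ramp c d) x = 0.
Proof.
move=> d0 xc; rewrite derive1_comp_affine; last exact: smooth_smooth_step.
rewrite -mulrBr mulrC (mulrC _ (x - c)) derive1_smooth_step_out ?mul0r//.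
by case/orP: xc => xc; apply/orP; [left; rewrite ler_pdivrMr//|right; rewrite ler_pdivlMr//]; lra.
Qed.

Lemma derive1_ramp_bounded : exists2 C, 0 < C &
  forall c d x, 0 < d -> `|derive1 (ramp c d) x| <= C / d.
Proof.
have [C C0 CP] := @derive1_smooth_step_bounded R; exists C => // c d x d0.
rewrite derive1_comp_affine; last exact: smooth_smooth_step.
rewrite normrM gtr0_norm ?invr_gt0// mulrC ler_wpM2r//.
by rewrite invr_ge0 ltW.
Qed.

Definition plateau (s T d x : R) : R := ramp s d x * (1 - ramp (T - d) d x).

Lemma smooth_plateau (s T d : R) : smooth (plateau s T d).
Proof.
have -> : plateau s T d = ramp s d \* (cst 1 \+ (cst (- 1) \* ramp (T - d) d)).
  by apply/funext => x; rewrite /plateau/= mulN1r.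
apply: smoothM; first exact: smooth_ramp.
apply: smoothD; first exact: smooth_cst.
by apply: smoothM; [exact: smooth_cst|exact: smooth_ramp].
Qed.

Lemma plateau_itv (s T d x : R) : 0 <= plateau s T d x <= 1.
Proof.
have /andP[a0 a1] := ramp_itv s d x; have /andP[b0 b1] := ramp_itv (T - d) d x.
by rewrite mulr_ge0 ?subr_ge0//= mulr_ile1// ?subr_ge0// gerBl.
Qed.

Lemma plateau_out (s T d x : R) : 0 < d -> (x <= s) || (T <= x) -> plateau s T d x = 0.
Proof.
move=> d0 /orP[xs|Tx]; rewrite /plateau; first by rewrite ramp0// mul0r.
by rewrite (_ : ramp (T - d) d x = 1) ?subrr ?mulr0// ramp1// subrK.
Qed.

Lemma plateau_in (s T d x : R) : 0 < d -> s + d <= x <= T - d -> plateau s T d x = 1.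
Proof.
by move=> d0 /andP[sx xT]; rewrite /plateau ramp1// ramp0// subr0 mulr1.
Qed.

End ramps.

(** * Weak derivatives: the fundamental theorem and uniqueness *)

Section weak_derivatives.
Context {R : realType}.
Local Notation mu := (@lebesgue_measure R).
Implicit Types f g u v w phi psi : R -> R.

(** The derivative of a ramp is an approximate identity at c: it is
    supported in a segment of length d, bounded by C / d, and of integral 1. *)
Lemma mollified_jump u (c e : R) : 0 < c -> 0 < e ->
  {within half_line, continuous u} ->
  exists2 d0 : R, 0 < d0 & forall d, 0 < d < d0 ->
    exists r, (\int[mu]_(x in half_line) (u x * derive1 (ramp c d) x)%:E)%E = r%:E
      /\ `|r - u c| <= e.
Proof.
move=> c0 e0 cu; have [C C0 CP] := @derive1_ramp_bounded R.
have ucont : {for c, continuous u}.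
  move: cu; rewrite continuous_open_subspace; last exact: interval_open.
  by apply; rewrite inE /half_line/= in_itv/= c0.
have eC : 0 < e / C by rewrite divr_gt0.
move/cvgrPdist_le : ucont => /(_ _ eC) /nbhs_ballP[d0 /= d00 dP].
exists d0 => // d /andP[d_gt0 dd0].
have sub : `[c, c + d] `<=` half_line by exact: segment_half_line.
rewrite (@integral_support R `[c, (c + d)%R])//; last first.
  move=> x _ /= /negP; rewrite in_itv/= negb_and -!ltNge => xc.
  rewrite derive1_ramp_out ?mulr0//.
  by case/orP: xc => /ltW ->; rewrite ?orbT.
have cr : {within `[c, (c + d)%R], continuous (derive1 (ramp c d))}.
  apply: continuous_subspaceT => x.
  exact/smooth_continuous/smooth_derive1/smooth_ramp.
have cud := @half_line_segment_continuous R u c (c + d) c0 cu.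
have cuc : {within `[c, (c + d)%R], continuous (cst (u c))}.
  by apply: continuous_subspaceT => x; exact: cvg_cst.
have I1 : mu.-integrable `[c, c + d] (fun x => (u x * derive1 (ramp c d) x)%:E).
  exact/within_continuous_segment_integrable/segment_continuousM.
have I2 : mu.-integrable `[c, c + d] (fun x => (u c * derive1 (ramp c d) x)%:E).
  exact/within_continuous_segment_integrable/segment_continuousM.
have I12 : mu.-integrable `[c, c + d] (fun x => (u x * derive1 (ramp c d) x - u c * derive1 (ramp c d) x)%:E).
  exact: lebesgue_integrableB I1 I2.
have r1 : \int[mu]_(x in `[c, (c + d)%R]) (u c * derive1 (ramp c d) x) = u c.
  rewrite RintegralZl//; last exact: within_continuous_segment_integrable.
  rewrite /Rintegral integral_derive1_smooth ?ltrDl//; last exact: smooth_ramp.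
  by rewrite /= ramp1// ramp0// subr0 mulr1.
exists (\int[mu]_(x in `[c, (c + d)%R]) (u x * derive1 (ramp c d) x)); split.
  by rewrite /Rintegral fineK//; apply: integrable_fin_num => //; exact: I1.
rewrite -[X in _ - X]r1 -RintegralB//.
apply: le_trans (le_normr_Rintegral _ _) _ => //.
have le1 : \int[mu]_(x in `[c, (c + d)%R]) `|u x * derive1 (ramp c d) x - u c * derive1 (ramp c d) x| <=
    \int[mu]_(x in `[c, (c + d)%R]) (e / d).
  apply: le_Rintegral => //.
  - exact: integrable_norm I12.
  - apply: within_continuous_segment_integrable.
    by apply: continuous_subspaceT => x; exact: cvg_cst.
  move=> x /= /[!in_itv]/= /andP[cx xd].
  rewrite -mulrBl normrM.
  have -> : e / d = (e / C) * (C / d) by field; rewrite !gt_eqF.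
  apply: ler_pM => //; last exact: CP.
  rewrite distrC; apply: dP; rewrite /ball/= distrC ger0_norm; lra.
apply: le_trans le1 _; rewrite Rintegral_cst//=.
rewrite lebesgue_measure_itv/= lte_fin ltrDl d_gt0/=.
by rewrite (addrC c) addrK divfK// gt_eqF.
Qed.

(** Test against the smoothed indicator [ramp s d - ramp t d] of ]s, t] and let
    d tend to 0: the side of u converges to u s - u t by continuity, the side
    of v by dominated convergence. *)
Lemma weak_derivative_ftc u v (s t : R) :
  {within half_line, continuous u} -> weak_derivative u v -> 0 < s -> s < t ->
  u t - u s = \int[mu]_(x in `[s, t]) v x.
Proof.
move=> cu [lv uv] s0 st.
have t0 : 0 < t by exact: lt_trans st.
have mu_ := half_line_continuous_measurable cu.
have mv : measurable_fun half_line v by case: lv.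
pose d n : R := n.+1%:R^-1.
have d0 n : 0 < d n by rewrite invr_gt0.
have d1 n : d n <= 1 by rewrite invf_le1// ler1n.
(* the bound 1 on d n keeps all supports inside [s, t + 1] *)
pose phi n : R -> R := ramp s (d n) \+ (cst (-1) \* ramp t (d n)).
have srt n : smooth (ramp t (d n)) by exact: smooth_ramp.
have srs n : smooth (ramp s (d n)) by exact: smooth_ramp.
have sm1 n : smooth (cst (-1) \* ramp t (d n)).
  by apply: smoothM; [exact: smooth_cst|exact: srt].
have sphi n : smooth (phi n) by apply: smoothD.
have phis n x : x <= s -> phi n x = 0.
  move=> xs; rewrite /phi/= !ramp0 ?mulr0 ?addr0//; exact: ltW (le_lt_trans xs st).
have phit n x : t + d n <= x -> phi n x = 0.
  by move=> xt; rewrite /phi/= !ramp1//; [lra|have := st; lra].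
have tphi n : test_function (phi n).
  apply: (@test_function_itv R _ s (t + 1)) => // x; apply: contraNT.
  rewrite negb_and -!ltNge => /orP[/ltW/phis->//|tx].
  by rewrite phit// (le_trans _ (ltW tx))// lerD2l.
have I1 : (\int[mu]_(x in half_line) (v x * phi n x)%:E)%E @[n --> \oo] -->
    (\int[mu]_(x in `[s, t]) v x)%:E.
  have iv1 := @locally_integrable_segment R v s (t + 1) s0 lv.
  have iv := @locally_integrable_segment R v s t s0 lv.
  have sub : `[s, t + 1] `<=` half_line by exact: segment_half_line.
  have -> : (\int[mu]_(x in `[s, t]) v x)%:E =
      (\int[mu]_(x in `[s, (t + 1)%R]) ((EFin \o v) \_ `]s, t]) x)%E.
    rewrite -integral_mkcondr.
    have -> : `[s, t + 1] `&` `]s, t] = `]s, t]%classic.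
      apply: setIidr => x /=; rewrite !in_itv/=; lra.
    rewrite integral_itv_obnd_cbnd; last first.
      apply/measurable_EFinP; apply: measurable_sub_half_line mv.
      apply: subset_trans (@segment_half_line R s t s0).
      by apply: subset_itvr; rewrite bnd_simp.
    by rewrite /Rintegral fineK//; apply: integrable_fin_num.
  rewrite (_ : (fun n => _) = (fun n => \int[mu]_(x in `[s, (t + 1)%R]) (v x * phi n x)%:E)%E); last first.
    apply/funext => n; apply: integral_support => // x _ /= /negP.
    rewrite in_itv/= negb_and -!ltNge => /orP[/ltW/phis->|tx]; first by rewrite mulr0.
    by rewrite phit ?mulr0// (le_trans _ (ltW tx))// lerD2l.
  have dlt a : 0 < a -> \forall n \near \oo, d n < a.
    by move=> a0; have := near_infty_natSinv_lt (PosNum a0).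
  have mfn n : measurable_fun `[s, t + 1] (fun x => (v x * phi n x)%:E).
    apply/measurable_EFinP; apply: measurable_funM; first exact: measurable_sub_half_line mv.
    by apply: continuous_measurableS => //; exact: smooth_continuous.
  have mf : measurable_fun `[s, t + 1] ((EFin \o v) \_ `]s, t]).
    apply: (measurable_restrict _ _ _).1 => //.
    apply/measurable_EFinP; apply: measurable_sub_half_line mv.
    by apply: subset_trans sub => x /= [].
  have cvf : {ae mu, forall x, `[s, t + 1]%classic x ->
      (v x * phi n x)%:E @[n --> \oo] --> ((EFin \o v) \_ `]s, t]) x}.
    apply: aeW => x /=; rewrite in_itv/= => /andP[sx xt].
    apply: cvg_near_cst; rewrite patchE; case: ifPn => [|].
      rewrite inE/= in_itv/= => /andP[sx' xt'].
      have : \forall n \near \oo, d n < x - s by apply: dlt; rewrite subr_gt0.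
      apply: filterS => n dn; rewrite /phi/= ramp1//; last lra.
      by rewrite ramp0// mulr0 addr0 mulr1.
    rewrite notin_setE/= in_itv/= => /negP; rewrite negb_and -!leNgt => /orP[xs|].
      by near=> n; rewrite phis// mulr0.
    rewrite -ltNge => tx.
    have : \forall n \near \oo, d n < x - t by apply: dlt; rewrite subr_gt0.
    by apply: filterS => n dn; rewrite phit ?mulr0//; lra.
  have dom : {ae mu, forall x, forall n, `[s, t + 1]%classic x ->
      (`|(v x * phi n x)%:E| <= `|(v x)%:E|)%E}.
    apply: aeW => x n _; rewrite lee_fin normrM ler_piMr//.
    have /andP[a1 a2] := ramp_itv s (d n) x; have /andP[b1 b2] := ramp_itv t (d n) x.
    by rewrite ler_norml /phi/=; apply/andP; split; lra.
  exact: lebesgue_dominated_cvg mfn mf cvf (integrable_abse iv1) dom.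
have I2 (e : R) : 0 < e -> \forall n \near \oo, exists r,
  (\int[mu]_(x in half_line) (u x * derive1 (phi n) x)%:E)%E = r%:E /\
  `|r - (u s - u t)| <= e.
  move=> e0; have e20 : 0 < e / 2 by rewrite divr_gt0.
  have [a a0 Ha] := mollified_jump s0 e20 cu.
  have [b b0 Hb] := mollified_jump t0 e20 cu.
  have da : \forall n \near \oo, d n < a.
    by have := near_infty_natSinv_lt (PosNum a0).
  have db : \forall n \near \oo, d n < b.
    by have := near_infty_natSinv_lt (PosNum b0).
  near=> n.
  have [|r1 [E1 B1]] := Ha (d n); first by rewrite d0/=; near: n.
  have [|r2 [E2 B2]] := Hb (d n); first by rewrite d0/=; near: n.
  exists (r1 - r2); split; last first.
    have -> : r1 - r2 - (u s - u t) = (r1 - u s) - (r2 - u t) by ring.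
    by apply: le_trans (ler_normB _ _) _; rewrite (splitr e) lerD.
  have mM c : measurable_fun half_line (fun x => u x * derive1 (ramp c (d n)) x).
    apply: measurable_funM => //.
    apply: continuous_measurableS; first exact: measurable_half_line.
    exact/smooth_continuous/smooth_derive1/smooth_ramp.
  have iM c r : (\int[mu]_(x in half_line) (u x * derive1 (ramp c (d n)) x)%:E)%E = r%:E ->
     mu.-integrable half_line (fun x => (u x * derive1 (ramp c (d n)) x)%:E).
    move=> E; apply: lebesgue_fin_num_integrable => //; last by rewrite E.
    exact: measurable_half_line.
  rewrite EFinB -E1 -E2 -integralB_EFin//; [|exact: measurable_half_line|exact: iM E1|exact: iM E2].
  apply: eq_integral => x _; rewrite /phi derive1D_smooth// derive1Z_smooth//=.
  by rewrite mulN1r -EFinB mulrBr.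
apply/eqP; rewrite -subr_eq0 -normr_le0; apply/ler_addgt0Pr => e e0; rewrite add0r.
have e20 : 0 < e / 2 by rewrite divr_gt0.
have H1 := I2 _ e20.
move/fine_cvgP : I1 => [fin1 /cvgrPdist_le /(_ _ e20) H2].
near \oo => n.
have [|r [E B]] := near H1 n; first by [].
have F : (\int[mu]_(x in half_line) (v x * phi n x)%:E)%E \is a fin_num by near: n.
have H3 : `|\int[mu]_(x in `[s, t]) v x - \int[mu]_(x in half_line) (v x * phi n x)| <= e / 2.
  by near: n.
have := uv _ (tphi n); rewrite E => /(congr1 fine); rewrite fineN/= -/(Rintegral _ _ _).
set J := Rintegral _ _ _ => rJ; rewrite -/J in H3.
rewrite (_ : _ - _ = (r - (u s - u t)) - (\int[mu]_(x in `[s, t]) v x - J)); last by rewrite rJ; ring.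
by apply: le_trans (ler_normB _ _) _; rewrite (splitr e) lerD.
Unshelve. all: end_near. Qed.

(** The primitives of w vanish, while almost everywhere w is the derivative of
    its primitive. *)
Lemma ae_zero_of_zero_integrals w : locally_integrable half_line w ->
  (forall s t, 0 < s -> s < t -> \int[mu]_(x in `[s, t]) w x = 0) ->
  {ae mu, forall x, half_line x -> w x = 0}.
Proof.
move=> lw w0.
suff H n : {ae mu, forall x, n.+1%:R^-1 < x < n.+2%:R -> w x = 0}.
  have := ae_foralln H; apply: filterS => x Hx; rewrite /half_line/= in_itv/= andbT => x0.
  near \oo => n; apply: (Hx n); apply/andP; split.
    by near: n; have := near_infty_natSinv_lt (PosNum x0).
  near: n; have := @nbhs_infty_gtr R x; apply: filterS => m xm.
  by apply: lt_le_trans xm _; rewrite ler_nat; do 2 apply: leqW.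
set a : R := n.+1%:R^-1; set b : R := n.+2%:R.
have a0 : 0 < a by rewrite invr_gt0.
have ab : a < b by apply: (@le_lt_trans _ _ 1); rewrite ?invf_le1 ?ler1n ?ltr1n.
have iw := @locally_integrable_segment R w a b a0 lw.
have lf : locally_integrable setT (w \_ `[a, b]) by exact: integrable_locally iw.
have iT : mu.-integrable setT (EFin \o (w \_ `[a, b])).
  by rewrite -restrict_EFin; apply/(integrable_mkcond _ _).1.
have if_ y : mu.-integrable `[a, y] (EFin \o (w \_ `[a, b])).
  exact: integrableS iT.
(* on ]a, b[ the primitive of w is constantly 0 *)
have := @FTC1 R (w \_ `[a, b]) (BLeft a) if_ lf.
apply: lebesgue_aeS => x Hx /andP[ax xb].
have [|_] := Hx; first by rewrite /= lte_fin.
rewrite patchE ifT; last by rewrite inE/= in_itv/= !ltW.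
move=> <-; apply: (@derive1_near_cst R _ 0).
have : \forall y \near x, y \in `]a, b[ by apply: near_in_itvoo; rewrite in_itv/= ax.
apply: filterS => y; rewrite in_itv/= => /andP[ay yb].
rewrite -(w0 _ _ a0 ay); apply: eq_Rintegral => z; rewrite inE/= in_itv/= => /andP[az zy].
by rewrite patchE ifT// inE/= in_itv/= az (le_trans zy (ltW yb)).
Unshelve. all: end_near. Qed.

Lemma weak_derivative_ae_unique u v1 v2 : {within half_line, continuous u} ->
  weak_derivative u v1 -> weak_derivative u v2 ->
  {ae mu, forall x, half_line x -> v1 x = v2 x}.
Proof.
move=> cu uv1 uv2.
have [l1 l2] := (uv1.1, uv2.1).
have H : {ae mu, forall x, half_line x -> (v1 \- v2) x = 0}.
  apply: ae_zero_of_zero_integrals; first exact: locally_integrableB.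
  move=> s t s0 st; rewrite RintegralB//; [|exact: locally_integrable_segment..].
  by rewrite -(weak_derivative_ftc cu uv1)// -(weak_derivative_ftc cu uv2)// subrr.
by apply: lebesgue_aeS H => x Hx /Hx /eqP; rewrite subr_eq0 => /eqP.
Qed.

Lemma wderiv_weak_derivative u v : weak_derivative u v -> weak_derivative u (wderiv u).
Proof. by move=> uv; exact: (@xgetPex _ (cst 0) [set v | weak_derivative u v] (ex_intro _ v uv)). Qed.

Lemma weighted_norm_ae_eq (p : R) (w f g : R -> R) :
  measurable_fun half_line w -> measurable_fun half_line f -> measurable_fun half_line g ->
  {ae mu, forall x, half_line x -> f x = g x} ->
  weighted_norm p w f = weighted_norm p w g.
Proof.
move=> mw mf mg fg; apply: (congr1 (fun I => (I `^ p^-1)%E)).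
apply: ae_eq_integral => //.
- exact: measurable_half_line.
- apply/measurable_EFinP; apply: measurable_funM => //.
  apply: (measurableT_comp (measurable_powR p)); exact: measurableT_comp.
- apply/measurable_EFinP; apply: measurable_funM => //.
  apply: (measurableT_comp (measurable_powR p)); exact: measurableT_comp.
by apply: lebesgue_aeS fg => x H /H ->.
Qed.

(** This gives a meaning to the pairings with test functions, which can then
    be added. *)
Lemma integrable_mul_compact_support w psi (a b : R) : 0 < a ->
  locally_integrable half_line w -> continuous psi ->
  (forall x, ~~ (a <= x <= b) -> psi x = 0) ->
  mu.-integrable half_line (fun x => (w x * psi x)%:E).
Proof.
move=> a0 lw cpsi psi0.
have mH := @measurable_half_line R.
have mpsi (A : set R) : measurable A -> measurable_fun A psi.
  by move=> mA; exact: continuous_measurableS.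
have mw := locally_integrable_measurable lw.
have sub : `[a, b] `<=` (half_line : set R) by exact: segment_half_line.
have iw := @locally_integrable_segment R w a b a0 lw.
have bpsi : [bounded psi x | x in `[a, b]].
  have /compact_bounded[M [_ mrt]] := continuous_compact (continuous_subspaceT cpsi) (@segment_compact _ a b).
  by exists M; split; rewrite ?num_real // => ? ? ? ?; exact: mrt.
have mab : measurable (`[a, b]%classic : set R) by exact: measurable_itv.
have iab : mu.-integrable `[a, b] (fun x => (w x * psi x)%:E).
  exact: (integrableMl _ iw (mpsi _ mab) bpsi).
apply/integrableP; split.
  by apply/measurable_EFinP; apply: measurable_funM => //; exact: mpsi.
rewrite (@integral_support R `[a, b])//; first by case/integrableP: iab.
move=> x _ /= /negP; rewrite in_itv/= => /psi0 ->.
by rewrite mulr0 normr0.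
Qed.

(** Integration by parts over a segment beyond which the test function vanishes. *)
Lemma weak_derivative_smooth phi : smooth phi -> weak_derivative phi (derive1 phi).
Proof.
move=> sphi; have sphi' := smooth_derive1 sphi.
split.
  apply: half_line_continuous_locally_integrable; apply: continuous_subspaceT => x.
  exact: smooth_continuous.
move=> psi tpsi; have [a [b [a0 ab Hpsi]]] := test_function_supp tpsi.
have spsi : smooth psi by case: tpsi.
have sub : `[a / 2, b + 1] `<=` (half_line : set R) by apply: segment_half_line; lra.
have out (x : R) : ~ `[a / 2, b + 1]%classic x -> ~~ (a <= x <= b).
  by move=> /= /negP; rewrite in_itv/=; apply: contra; lra.
rewrite (@integral_support R `[a / 2, b + 1])//; last first.
  by move=> x _ /out/Hpsi[_ ->]; rewrite mulr0.
rewrite [in RHS](@integral_support R `[a / 2, b + 1])//; last first.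
  by move=> x _ /out/Hpsi[-> _]; rewrite mulr0.
have c1 f (c d : R) : smooth f -> {within `[c, d], continuous f}.
  by move=> sf; apply: continuous_subspaceT => x; exact: smooth_continuous.
rewrite (@integration_by_parts R phi psi (derive1 phi) (derive1 psi)).
- rewrite (Hpsi (b + 1) _).1; last by apply/negP => /andP[]; lra.
  rewrite (Hpsi (a / 2) _).1; last by apply/negP => /andP[]; lra.
  by rewrite !mulr0 subrr sub0e.
- lra.
- by apply: c1.
- exact: smooth_derivable_oo_LRcontinuous.
- by [].
- by apply: c1; exact: smooth_derive1.
- exact: smooth_derivable_oo_LRcontinuous.
- by [].
Qed.

Lemma weak_derivativeB u v phi psi : locally_integrable half_line u ->
  locally_integrable half_line phi ->
  weak_derivative u v -> weak_derivative phi psi ->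
  weak_derivative (u \- phi) (v \- psi).
Proof.
move=> lu lphi [lv uv] [lpsi phipsi]; split; first exact: locally_integrableB.
move=> t tt; have [a [b [a0 ab Ht]]] := test_function_supp tt.
have st : smooth t by case: tt.
have ct := smooth_continuous st.
have ct' := smooth_continuous (smooth_derive1 st).
have I w : locally_integrable half_line w -> mu.-integrable half_line (fun x => (w x * t x)%:E).
  by move=> lw; apply: (@integrable_mul_compact_support w t a b) => // x /Ht[].
have I' w : locally_integrable half_line w -> mu.-integrable half_line (fun x => (w x * derive1 t x)%:E).
  by move=> lw; apply: (@integrable_mul_compact_support w (derive1 t) a b) => // x /Ht[].
under eq_integral do rewrite /= mulrBl EFinB.
under [in RHS]eq_integral do rewrite /= mulrBl EFinB.
have mH := @measurable_half_line R.
rewrite integralB_EFin//; [|exact: I'|exact: I'].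
rewrite integralB_EFin//; [|exact: I|exact: I].
rewrite uv// phipsi// oppeB ?fin_num_adde_defr//; last first.
  exact: integrable_fin_num (I _ lv).
by rewrite oppeK.
Qed.

End weak_derivatives.

(** * Weighted energies and the behaviour at infinity *)

Section energy.
Context {R : realType}.
Local Notation mu := (@lebesgue_measure R).
Implicit Types f h u v : R -> R.

(** Dominated convergence; the tails at 0 and at infinity are treated
    together. *)
Lemma integral_tail h (e : R) : 0 < e -> measurable_fun half_line h ->
  (forall x, half_line x -> 0 <= h x) ->
  (\int[mu]_(x in half_line) (h x)%:E < +oo)%E ->
  exists2 N : R, 1 <= N & forall A : set R, measurable A -> A `<=` half_line ->
    (forall x, A x -> x < N^-1 \/ N < x) -> (\int[mu]_(x in A) (h x)%:E < e%:E)%E.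
Proof.
move=> e0 mh h0 ih.
pose G (n : nat) : set R := half_line `&` (`]-oo, n.+1%:R^-1[ `|` `]n.+1%:R, +oo[).
have mH := @measurable_half_line R.
have mG n : measurable (G n) by apply: measurableI => //; apply: measurableU.
have GH n : G n `<=` half_line by move=> x [].
have mhE : measurable_fun half_line (fun x => (h x)%:E) by exact/measurable_EFinP.
have ihE : mu.-integrable half_line (fun x => (h x)%:E).
  apply/integrableP; split => //; rewrite (le_lt_trans _ ih)//.
  rewrite le_eqVlt; apply/orP; left; apply/eqP; apply: eq_integral => x /set_mem xH.
  by rewrite gee0_abs// lee_fin h0.
have cv : (\int[mu]_(x in half_line) ((fun x => (h x)%:E) \_ (G n)) x)%E @[n --> \oo] -->
    (\int[mu]_(x in half_line) (cst 0 x))%E.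
  apply: lebesgue_dominated_cvg ihE _ => //.
  - move=> n; apply: (measurable_restrict _ _ _).1 => //.
    by rewrite setIidr//; apply: measurable_funS mhE.
  - apply: aeW => x xH; apply: cvg_near_cst.
    have x0 : 0 < x by move: xH; rewrite /half_line/= in_itv/= andbT.
    near=> n; rewrite patchE ifF//; apply/negbTE; rewrite notin_setE => -[_].
    rewrite /= !in_itv/= andbT => -[]; apply/negP; rewrite -leNgt ltW//.
      by near: n; have := near_infty_natSinv_lt (PosNum x0).
    near: n; have := @nbhs_infty_gtr R x; apply: filterS => m xm.
    by apply: lt_le_trans xm _; rewrite ler_nat; apply: leqW.
  - apply: aeW => x n xH; rewrite patchE; case: ifPn => _.
      by rewrite gee0_abs// lee_fin h0.
    by rewrite abse0 lee_fin h0.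
rewrite integral0 in cv.
move/fine_cvgP : cv => [fin1 /cvgrPdist_lt /(_ _ e0) H].
near \oo => n.
exists n.+1%:R; first by rewrite ler1n.
move=> A mA AH AN.
apply: (@le_lt_trans _ _ (\int[mu]_(x in G n) (h x)%:E)%E).
  apply: lebesgue_ge0_subset_integral => //.
  - by apply: measurable_funS mh.
  - by move=> x /GH/h0.
  - move=> x Ax; split; first exact: AH.
    by have [?|?] := AN _ Ax; [left|right]; rewrite /= in_itv/= ?andbT.
have E : (\int[mu]_(x in half_line) ((fun x => (h x)%:E) \_ (G n)) x = \int[mu]_(x in G n) (h x)%:E)%E.
  by rewrite -integral_mkcondr setIidr.
have F : (\int[mu]_(x in half_line) ((fun x => (h x)%:E) \_ (G n)) x)%E \is a fin_num by near: n.
have B : `|0 - fine (\int[mu]_(x in half_line) ((fun x => (h x)%:E) \_ (G n)) x)%E| < e by near: n.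
rewrite -E -(fineK F) lte_fin.
by move: B; rewrite sub0r normrN; apply: le_lt_trans; exact: ler_norm.
Unshelve. all: end_near. Qed.

Section fixed_exponent.
Variables (p : R) (hp : 1 < p).
Let p0 : 0 < p. Proof. exact: lt_trans hp. Qed.

(** The p-th power of the weighted norm, which unlike the norm is additive in
    the set A. *)
Definition energy (A : set R) f : \bar R :=
  (\int[mu]_(x in A) (`|f x| `^ p * x `^ (p - 1))%:E)%E.

Lemma measurable_energy_density (A : set R) f : measurable_fun A f ->
  measurable_fun A (fun x => `|f x| `^ p * x `^ (p - 1)).
Proof.
move=> mf; apply: measurable_funM.
  by apply: (measurableT_comp (measurable_powR p)); exact: measurableT_comp.
by apply: (@measurable_funS _ _ _ _ setT) => //; exact: measurable_powR.
Qed.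

Lemma energy_density_ge0 f x : 0 <= `|f x| `^ p * x `^ (p - 1).
Proof. by rewrite mulr_ge0// powR_ge0. Qed.

Lemma energy_subset (A B : set R) f : measurable A -> measurable B ->
  measurable_fun B f -> A `<=` B -> (energy A f <= energy B f)%E.
Proof.
move=> mA mB mf AB; apply: lebesgue_ge0_subset_integral => //.
- exact: measurable_energy_density.
- by move=> x _; exact: energy_density_ge0.
Qed.

Lemma energy_tail f (e : R) : 0 < e -> measurable_fun half_line f ->
  (energy half_line f < +oo)%E ->
  exists2 N : R, 1 <= N & forall A : set R, measurable A -> A `<=` half_line ->
    (forall x, A x -> x < N^-1 \/ N < x) -> (energy A f < e%:E)%E.
Proof.
move=> e0 mf Ef; apply: integral_tail => //; first exact: measurable_energy_density.
by move=> x _; exact: energy_density_ge0.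
Qed.

Lemma powR_split x : 0 < x -> x `^ p = x * x `^ (p - 1).
Proof. by move=> x0; rewrite mulr_powRB1// ltW. Qed.

(** If |f|^p x^p were larger than K throughout [a, 2a], the energy would be at
    least the integral of K / x, hence at least K / 2. *)
Lemma energy_pick f (a K : R) : 0 < a -> measurable_fun half_line f ->
  (energy `[a, (2 * a)%R] f < (K / 2)%:E)%E ->
  exists2 s, a <= s <= 2 * a & `|f s| `^ p * s `^ p <= K.
Proof.
move=> a0 mf EK; apply: contrapT => H.
have {}H s : a <= s <= 2 * a -> K < `|f s| `^ p * s `^ p.
  by move=> sa; rewrite ltNge; apply/negP => ?; apply: H; exists s.
move: EK; apply/negP; rewrite -leNgt.
have a2 : a <= 2 * a by lra.
have [K0|K0] := leP K 0.
  apply: (@le_trans _ _ 0%E); first by rewrite lee_fin; lra.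
  by apply: integral_ge0 => x _; rewrite lee_fin energy_density_ge0.
have -> : (K / 2)%:E = (\int[mu]_(x in `[a, (2 * a)%R]) (K / (2 * a))%:E)%E.
  by rewrite integral_segment_cst//; congr (_%:E); field; rewrite gt_eqF.
apply: lebesgue_ge0_le_integral => //.
- by move=> x _; rewrite divr_ge0; lra.
- apply: measurable_energy_density; apply: measurable_sub_half_line mf.
  exact: segment_half_line.
move=> x /=; rewrite in_itv/= => /andP[ax xa].
have x0 : 0 < x by exact: lt_le_trans ax.
rewrite ler_pdivrMr ?mulr_gt0//.
have := H x; rewrite ax xa (powR_split x0) => /(_ isT)/ltW/le_trans; apply.
by rewrite mulrCA mulrC ler_wpM2l ?energy_density_ge0.
Qed.

(** Replaces the inequality of Hoelder: either x <= d, or x^(p-1) > d^(p-1). *)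
Lemma young_split (x d : R) : 0 <= x -> 0 < d -> x <= d `^ (1 - p) * x `^ p + d.
Proof.
move=> x0 d0; have [xd|dx] := leP x d.
  by rewrite (le_trans xd)// lerDr mulr_ge0// powR_ge0.
apply: ler_wpDr; first exact: ltW.
have xg : 0 < x by exact: lt_trans dx.
have d1 : d `^ (1 - p) * d `^ (p - 1) = 1.
  rewrite -powRD ?(gt_eqF d0) ?implybT//.
  by rewrite (_ : 1 - p + (p - 1) = 0) ?powRr0//; ring.
rewrite (powR_split xg) mulrCA ler_peMr//.
rewrite -[leLHS]d1 ler_wpM2l ?powR_ge0// ge0_ler_powR// ?nnegrE ?subr_ge0 ltW//.
Qed.

(** [young_split] is applied to x |v x|, the p-th power of which is x times the
    energy density.  For t <= 2 s the constants no longer depend on s. *)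
Lemma integral_norm_energy v (s t d E : R) : 0 < s -> s < t -> 0 < d ->
  locally_integrable half_line v -> (energy `[s, t] v <= E%:E)%E ->
  s * (\int[mu]_(x in `[s, t]) `|v x|) <= t * d `^ (1 - p) * E + d * (t - s).
Proof.
move=> s0 st d0 lv EE.
have iv := @locally_integrable_segment R v s t s0 lv.
have mv : measurable_fun `[s, t] v.
  by apply: measurable_sub_half_line (locally_integrable_measurable lv) => //; exact: segment_half_line.
have iE : mu.-integrable `[s, t] (fun x => (`|v x| `^ p * x `^ (p - 1))%:E).
  apply: lebesgue_fin_num_integrable => //; first exact: measurable_energy_density.
  rewrite ge0_fin_numE; first exact: le_lt_trans EE (ltry _).
  by apply: integral_ge0 => x _; rewrite lee_fin energy_density_ge0.
have id_ : mu.-integrable `[s, t] (fun x => d%:E).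
  apply: (@within_continuous_segment_integrable R (cst d)).
  by apply: continuous_subspaceT => x; exact: cvg_cst.
have iEc : mu.-integrable `[s, t] (fun x => (t * d `^ (1 - p) * (`|v x| `^ p * x `^ (p - 1)))%:E).
  exact: lebesgue_integrableZ iE.
rewrite -RintegralZl//; last exact: (integrable_norm iv).
apply: (@le_trans _ _ (\int[mu]_(x in `[s, t]) (t * d `^ (1 - p) * (`|v x| `^ p * x `^ (p - 1)) + d))).
  apply: le_Rintegral => //.
  - exact: lebesgue_integrableZ (integrable_norm iv).
  - exact: lebesgue_integrableD iEc id_.
  move=> x /=; rewrite in_itv/= => /andP[sx xt].
  have x0 : 0 < x by exact: lt_le_trans sx.
  apply: (@le_trans _ _ (x * `|v x|)); first by rewrite ler_wpM2r.
  apply: le_trans (young_split _ d0) _; first by rewrite mulr_ge0// ltW.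
  rewrite lerD2r powRM ?(ltW x0)// (powR_split x0).
  rewrite (_ : _ * _ = x * (d `^ (1 - p) * (`|v x| `^ p * x `^ (p - 1)))); last by ring.
  by rewrite -mulrA ler_wpM2r// mulr_ge0 ?energy_density_ge0// powR_ge0.
rewrite RintegralD// RintegralZl// Rintegral_segment_cst ?(ltW st)//.
rewrite lerD2r ler_wpM2l//.
  by rewrite mulr_ge0 ?powR_ge0// ltW// (lt_trans s0).
rewrite -lee_fin /Rintegral fineK//.
exact: integrable_fin_num iE.
Qed.

Lemma powR_le_base (x y : R) : 0 <= x -> 0 <= y -> x `^ p <= y `^ p -> x <= y.
Proof.
move=> x0 y0; apply: contraTT; rewrite -!ltNge => yx.
by apply: gt0_ltr_powR; rewrite ?nnegrE.
Qed.

(** In the window [t/2, t], u is small at some point s by [energy_pick], and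
    between s and t it varies little by [integral_norm_energy]. *)
Lemma cvg_infty_of_energy u v : {within half_line, continuous u} ->
  weak_derivative u v -> (energy half_line u < +oo)%E -> (energy half_line v < +oo)%E ->
  u t @[t --> +oo] --> 0.
Proof.
move=> cu uv Eu Ev; have lv := uv.1.
have mu_ := half_line_continuous_measurable cu.
apply/cvgr0Pnorm_le => e3 e30.
pose e := e3 / 3; have e0 : 0 < e by rewrite divr_gt0.
(* with d = e in [integral_norm_energy], a tail of energy e^p / 2 makes each
   of its two terms at most s e *)
have ep0 : 0 < e `^ p / 2 by rewrite divr_gt0// powR_gt0.
have [N N1 HN] := energy_tail ep0 mu_ Eu.
have [M M1 HM] := energy_tail ep0 (locally_integrable_measurable lv) Ev.
have : \forall t \near +oo, 2 * (N + M) < t by apply: nbhs_pinfty_gt; rewrite num_real.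
apply: filterS => t Ht.
have HL (s : R) : N + M < s -> `[s, t] `<=` (half_line : set R).
  by move=> Ms; apply: segment_half_line; lra.
have [s /andP[s1 s2] Hs] : exists2 s, t / 2 <= s <= 2 * (t / 2) & `|u s| `^ p * s `^ p <= e `^ p.
  apply: energy_pick => //; first lra.
  apply: HN => //.
    by apply: segment_half_line; lra.
  by move=> x /=; rewrite in_itv/= => /andP[? ?]; right; lra.
have us : `|u s| <= e.
  apply: powR_le_base => //; first exact: ltW.
  apply: le_trans Hs; rewrite ler_peMr ?powR_ge0//.
  by rewrite -[leLHS](powRr0 s) ler_powR ?(ltW p0)//; lra.
have st : s <= t by lra.
have [->|st'] := eqVneq t s; first by rewrite (le_trans us)//; rewrite /e; lra.
have {}st : s < t by rewrite lt_neqAle eq_sym st' st.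
have s0 : 0 < s by lra.
have iv := @locally_integrable_segment R v s t s0 lv.
have D : `|u t - u s| <= \int[mu]_(x in `[s, t]) `|v x|.
  by rewrite (weak_derivative_ftc cu uv s0 st); exact: le_normr_Rintegral.
have Es : (energy `[s, t] v <= (e `^ p / 2)%:E)%E.
  apply/ltW/HM => //; first by apply: HL; lra.
  by move=> x /=; rewrite in_itv/= => /andP[? ?]; right; lra.
have := @integral_norm_energy v s t e _ s0 st e0 lv Es.
have -> : t * e `^ (1 - p) * (e `^ p / 2) = t * e / 2.
  rewrite -mulrA (mulrA (_ `^ _)) -powRD ?(gt_eqF e0) ?implybT//.
  by rewrite subrK powRr1 ?(ltW e0)// mulrA.
move=> I.
have {}I : \int[mu]_(x in `[s, t]) `|v x| <= e + e.
  rewrite -(ler_pM2l s0); apply: le_trans I _; nra.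
rewrite -[u t](subrK (u s)); apply: le_trans (ler_normD _ _) _.
have -> : e3 = (e + e) + e by rewrite /e; lra.
by apply: lerD => //; exact: le_trans D I.
Qed.

End fixed_exponent.

End energy.

(** * Calculus of energies *)

Section energy_calculus.
Context {R : realType}.
Local Notation mu := (@lebesgue_measure R).
Implicit Types f g : R -> R.

Section fixed_exponent.
Variables (p : R) (hp : 1 < p).
Let p0 : 0 < p. Proof. exact: lt_trans hp. Qed.

(** |x + y| is at most twice the larger of |x| and |y|. *)
Lemma powR_normD_le (x y : R) : `|x + y| `^ p <= 2 `^ p * (`|x| `^ p + `|y| `^ p).
Proof.
wlog xy : x y / `|x| <= `|y| => [H|].
  have [xy|/ltW yx] := leP `|x| `|y|; first exact: H.
  by rewrite addrC [X in _ * X]addrC; exact: H.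
apply: (@le_trans _ _ (2 `^ p * `|y| `^ p)); last first.
  by rewrite ler_wpM2l ?powR_ge0// lerDr powR_ge0.
rewrite -powRM//; apply: ge0_ler_powR; rewrite ?nnegrE ?(ltW p0) ?mulr_ge0//.
by apply: le_trans (ler_normD _ _) _; lra.
Qed.

(** A quasi-triangle inequality; constants are harmless in what follows, since
    the energies to be bounded can be made arbitrarily small. *)
Lemma energyD_le (A : set R) f g : measurable A -> measurable_fun A f -> measurable_fun A g ->
  (energy p A (f \+ g)%R <= (2 `^ p)%:E * (energy p A f + energy p A g))%E.
Proof.
move=> mA mf mg; rewrite /energy -ge0_integralD//; first last.
- by apply/measurable_EFinP; exact: measurable_energy_density.
- by move=> x _; rewrite lee_fin energy_density_ge0.
- by apply/measurable_EFinP; exact: measurable_energy_density.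
- by move=> x _; rewrite lee_fin energy_density_ge0.
rewrite -ge0_integralZl_EFin ?powR_ge0//; first last.
- apply: emeasurable_funD; apply/measurable_EFinP; exact: measurable_energy_density.
- by move=> x _; rewrite adde_ge0// lee_fin energy_density_ge0.
apply: (@lebesgue_ge0_le_integral R A _ (fun x => 2 `^ p * (`|f x| `^ p * x `^ (p - 1) + `|g x| `^ p * x `^ (p - 1)))) => //.
- by move=> x _; exact: energy_density_ge0.
- by apply: measurable_energy_density; exact: measurable_funD.
- apply: measurable_funM => //; apply: measurable_funD; exact: measurable_energy_density.
move=> x _ /=; rewrite -mulrDl mulrA ler_wpM2r ?powR_ge0//; exact: powR_normD_le.
Qed.

Lemma energyN (A : set R) f : energy p A (\- f) = energy p A f.
Proof. by apply: eq_integral => x _; rewrite normrN. Qed.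

Lemma energyB_le (A : set R) f g (a b : R) : measurable A ->
  measurable_fun A f -> measurable_fun A g ->
  (energy p A f <= a%:E)%E -> (energy p A g <= b%:E)%E ->
  (energy p A (f \- g)%R <= (2 `^ p * (a + b))%:E)%E.
Proof.
move=> mA mf mg fa gb.
have mN : measurable_fun A (\- g) by exact: measurableT_comp.
have := energyD_le mA mf mN; rewrite energyN => /le_trans; apply.
rewrite EFinM EFinD; apply: lee_wpmul2l; first by rewrite lee_fin powR_ge0.
exact: leeD.
Qed.

Lemma energyZ (A : set R) k f : measurable A -> measurable_fun A f ->
  energy p A (cst k \* f) = ((`|k| `^ p)%:E * energy p A f)%E.
Proof.
move=> mA mf; rewrite /energy -ge0_integralZl_EFin ?powR_ge0//; first last.
- by apply/measurable_EFinP; exact: measurable_energy_density.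
- by move=> x _; rewrite lee_fin energy_density_ge0.
by apply: eq_integral => x _; rewrite /= normrM powRM// -mulrA.
Qed.

(** One of the two summands of |f + g|^p vanishes at each point. *)
Lemma energy_disjointD (A : set R) f g : measurable A ->
  measurable_fun A f -> measurable_fun A g ->
  (forall x, f x = 0 \/ g x = 0) ->
  energy p A (f \+ g) = (energy p A f + energy p A g)%E.
Proof.
move=> mA mf mg fg; rewrite /energy -ge0_integralD//; first last.
- by apply/measurable_EFinP; exact: measurable_energy_density.
- by move=> x _; rewrite lee_fin energy_density_ge0.
- by apply/measurable_EFinP; exact: measurable_energy_density.
- by move=> x _; rewrite lee_fin energy_density_ge0.
apply: eq_integral => x _ /=; rewrite -EFinD -mulrDl; congr (_ * _)%:E.
by have [->|->] := fg x; rewrite normr0 powR0 ?gt_eqF// ?addr0 ?add0r.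
Qed.

Lemma energy_le_cst (A : set R) f (K b L : R) : measurable A -> A `<=` half_line ->
  measurable_fun A f -> (forall x, A x -> `|f x| <= K /\ x <= b) -> mu A = L%:E ->
  (energy p A f <= (K `^ p * b `^ (p - 1) * L)%:E)%E.
Proof.
move=> mA AH mf fK mL.
have -> : ((K `^ p * b `^ (p - 1) * L)%:E = \int[mu]_(x in A) (K `^ p * b `^ (p - 1))%:E)%E.
  by rewrite (@integral_cst _ _ _ mu _ mA) EFinM -mL.
apply: lebesgue_ge0_le_integral => //.
- by move=> x _; exact: energy_density_ge0.
- exact: measurable_energy_density.
move=> x Ax; have [fx xb] := fK x Ax.
have x0 : 0 < x by have := AH x Ax; rewrite half_lineE.
apply: ler_pM; rewrite ?powR_ge0//.
  by apply: ge0_ler_powR; rewrite ?nnegrE ?(ltW p0)//; apply: le_trans fx.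
by apply: ge0_ler_powR; rewrite ?nnegrE ?subr_ge0 ?(ltW hp) ?(ltW x0)// (le_trans (ltW x0)).
Qed.

(** For functions bounded by B, |f|^p <= B^(p-1) |f|: approximation in L^1 is
    then approximation in energy. *)
Lemma energy_bounded_le (f k : R -> R) (s T B : R) : 0 < s -> s < T ->
  measurable_fun `]s, T[ f -> measurable_fun `]s, T[ k ->
  (forall x, s < x < T -> `|f x| <= k x) -> (forall x, s < x < T -> `|f x| <= B) ->
  (energy p `]s, T[ f <= (B `^ (p - 1) * T `^ (p - 1))%:E * \int[mu]_(x in `]s, T[) (k x)%:E)%E.
Proof.
move=> s0 sT mf mk fk fB.
have q0 : 0 <= p - 1 by rewrite subr_ge0 ltW.
rewrite -ge0_integralZl_EFin ?mulr_ge0 ?powR_ge0//; first last.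
- exact/measurable_EFinP.
- by move=> x /=; rewrite in_itv/= lee_fin => xsT; apply: le_trans (fk x xsT).
apply: (@lebesgue_ge0_le_integral R `]s, T[ _ (fun x => B `^ (p - 1) * T `^ (p - 1) * k x)) => //.
- by move=> x _; exact: energy_density_ge0.
- exact: measurable_energy_density.
- by apply: measurable_funM => //; exact: measurable_cst.
move=> x /=; rewrite in_itv/= => xsT; have /andP[sx xT] := xsT.
have x0 : 0 < x by exact: lt_trans sx.
rewrite -(mulr_powRB1 (normr_ge0 (f x)) p0).
rewrite -mulrA [leRHS]mulrC.
have a1 := fk x xsT; have b1 := fB x xsT.
have h1 : `|f x| `^ (p - 1) <= B `^ (p - 1).
  by apply: ge0_ler_powR => //; rewrite nnegrE//; apply: le_trans b1.
have h2 : x `^ (p - 1) <= T `^ (p - 1).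
  by apply: ge0_ler_powR => //; rewrite ?nnegrE ltW// (lt_trans x0).
by apply: ler_pM => //; [rewrite mulr_ge0 ?powR_ge0|apply: ler_pM; rewrite ?powR_ge0].
Qed.

Lemma energy_oo_cc f (s t : R) : measurable_fun `]s, t[ f ->
  energy p `[s, t] f = energy p `]s, t[ f.
Proof.
move=> mf; apply: integral_itv_bndoo.
by apply/measurable_EFinP; exact: measurable_energy_density.
Qed.

Lemma energy_split3 f (s T a b c : R) : 0 < s -> s < T -> measurable_fun half_line f ->
  (energy p `]0%R, s] f <= a%:E)%E -> (energy p `]s, T[ f <= b%:E)%E ->
  (energy p `[T, +oo[ f <= c%:E)%E ->
  (energy p half_line f <= (a + b + c)%:E)%E.
Proof.
move=> s0 sT mf fa fb fc.
have mE := measurable_energy_density p mf.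
have mEE : measurable_fun half_line (fun x => (`|f x| `^ p * x `^ (p - 1))%:E).
  exact/measurable_EFinP.
have Hd : half_line = (`]0, s] `|` `]s, T[) `|` `[T, +oo[ :> set R.
  apply/seteqP; split => x; rewrite half_lineE /= !in_itv/= !andbT.
    move=> x0; have [xs|sx] := leP x s; first by left; left; rewrite x0.
    by have [Tx|xT] := leP T x; [right|left; right].
  by case=> [[/andP[]//|/andP[sx _]]|Tx]; [exact: lt_trans sx|exact: lt_le_trans (lt_trans s0 sT) Tx].
rewrite /energy in fa fb fc *.
rewrite Hd in mEE *.
rewrite ge0_integral_setU//=; first last.
- apply/disj_setPS => x [[]]; rewrite /= !in_itv/= ?andbT.
    by move=> /andP[_ xs] Tx; have := lt_le_trans sT (le_trans Tx xs); rewrite ltxx.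
  by move=> /andP[_ xT] Tx; have := lt_le_trans xT Tx; rewrite ltxx.
- by move=> x _; rewrite lee_fin energy_density_ge0.
- exact: measurableU.
rewrite !EFinD; apply: leeD => //.
rewrite ge0_integral_setU//=; first last.
- apply/disj_setPS => x []; rewrite /= !in_itv/=.
  by move=> /andP[_ xs] /andP[sx _]; have := lt_le_trans sx xs; rewrite ltxx.
- by move=> x _; rewrite lee_fin energy_density_ge0.
- by apply: measurable_funS mEE; [apply: measurableU => //; exact: measurableU|move=> x; left].
exact: leeD.
Qed.

End fixed_exponent.

End energy_calculus.

(** * Density of smooth functions in energy *)

Section density.
Context {R : realType}.
Local Notation mu := (@lebesgue_measure R).
Implicit Types f g h v w : R -> R.

(** An approximation on [a, c] that is constantly h c from c on is extended to
    [a, d] by adding a ramp from h c to h d, if h oscillates by at most eta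
    on [c, d].  The supremum of the points reached in this way is b. *)
Lemma smooth_uniform_approx h (a b eta : R) : continuous h -> a <= b -> 0 < eta ->
  exists2 f, smooth f & forall x, a <= x <= b -> `|h x - f x| <= eta.
Proof.
move=> ch ab eta0.
pose S : set R := [set c | a <= c <= b /\ exists f, [/\ smooth f,
  forall x, a <= x <= c -> `|h x - f x| <= eta & forall x, c <= x -> f x = h c]].
have Sa : S a.
  split; first by rewrite lexx ab.
  exists (cst (h a)); split => //; first exact: smooth_cst.
  move=> x /andP[ax xa]; have -> : x = a by apply/eqP; rewrite eq_le xa ax.
  by rewrite subrr normr0 ltW.
have Sstep c d : S c -> c < d -> d <= b ->
    (forall x y, c <= x <= d -> c <= y <= d -> `|h x - h y| <= eta) -> S d.
  move=> [/andP[ac cb] [f [sf fh fc]]] cd db osc; split.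
    by rewrite db andbT (le_trans ac (ltW cd)).
  have dc0 : 0 < d - c by rewrite subr_gt0.
  exists (f \+ (cst (h d - h c) \* ramp c (d - c))); split.
  - by apply: smoothD; [exact: sf|apply: smoothM; [exact: smooth_cst|exact: smooth_ramp]].
  - move=> x /andP[ax xd] /=; have [xc|cx] := leP x c.
      by rewrite ramp0// mulr0 addr0 fh// ax.
    rewrite fc ?(ltW cx)//.
    have /andP[r0 r1] := ramp_itv c (d - c) x.
    move: (ramp c (d - c) x) r0 r1 => r r0 r1.
    have B1 : `|h x - h c| <= eta by apply: osc; rewrite ?lexx ?(ltW cx) ?xd ?(ltW cd).
    have B2 : `|h x - h d| <= eta by apply: osc; rewrite ?lexx ?(ltW cx) ?xd ?(ltW cd).
    have -> : h x - (h c + (h d - h c) * r) = (1 - r) * (h x - h c) + r * (h x - h d) by ring.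
    apply: le_trans (ler_normD _ _) _; rewrite !normrM.
    rewrite (ger0_norm r0) (ger0_norm (_ : 0 <= 1 - r)) ?subr_ge0//.
    have -> : eta = (1 - r) * eta + r * eta by ring.
    by apply: lerD; apply: ler_wpM2l => //; rewrite subr_ge0.
  - by move=> x dx /=; rewrite fc ?ramp1 ?mulr1 ?(le_trans (ltW cd))//; [ring|rewrite subrKC].
have bS : ubound S b by move=> c [/andP[]].
have hS : has_sup S by split; [exists a|exists b].
pose c := sup S.
have ac : a <= c by apply: ub_le_sup Sa; exists b.
have cb : c <= b by apply: ge_sup => //; exists a.
have e20 : 0 < eta / 2 by rewrite divr_gt0.
have /cvgrPdist_le /(_ _ e20) /nbhs_ballP[d /= d0 dP] := ch c.
have osc x y : `|c - x| < d -> `|c - y| < d -> `|h x - h y| <= eta.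
  move=> cx cy; have -> : h x - h y = (h c - h y) - (h c - h x) by ring.
  by apply: le_trans (ler_normB _ _) _; rewrite (splitr eta) lerD//; apply: dP.
have [e Se ce] := sup_adherent d0 hS; rewrite -/c in ce.
have ec : e <= c by apply: ub_le_sup Se; exists b.
suff [_ [f [sf fh _]]] : S b by exists f.
pose t := Num.min b (c + d / 2).
have tb : t <= b by rewrite ge_min lexx.
have td : t <= c + d / 2 by rewrite ge_min lexx orbT.
have et : e <= t by rewrite le_min (le_trans ec cb)/=; lra.
have St : S t.
  have [<-//|et'] := eqVneq e t.
  apply: (Sstep e) => //; first by rewrite lt_neqAle et'.
  move=> x y /andP[ex xt] /andP[ey yt]; apply: osc; rewrite ltr_norml; apply/andP; split; lra.
have tc : t <= c by apply: ub_le_sup St; exists b.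
have [bc|] := leP b (c + d / 2); last first.
  by move=> bc; move: tc; rewrite /t min_r ?(ltW bc)//; lra.
by move: St; rewrite /t min_l.
Qed.

Definition clip (M x : R) : R := Num.max (- M) (Num.min M x).

Lemma clip_le M x : 0 <= M -> `|clip M x| <= M.
Proof.
move=> M0; rewrite ler_norml /clip le_max lexx/= ge_max ge_min lexx /=; lra.
Qed.

Lemma clip_id M x : `|x| <= M -> clip M x = x.
Proof.
by rewrite ler_norml => /andP[a b]; rewrite /clip min_r// max_r.
Qed.

Lemma clip_lip M x y : `|clip M x - clip M y| <= `|x - y|.
Proof.
wlog xy : x y / x <= y => [H|].
  by have [xy|/ltW yx] := leP x y; [exact: H|rewrite distrC (distrC x); exact: H].
rewrite (distrC x) (ger0_norm (_ : 0 <= y - x)) ?subr_ge0// ler_norml /clip.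
case: (leP M x) => h1; case: (leP M y) => h2.
- by case: (leP (- M) M) => h3; apply/andP; split; lra.
- by exfalso; lra.
- by case: (leP (- M) x) => h3; case: (leP (- M) M) => h4; apply/andP; split; lra.
- by case: (leP (- M) x) => h3; case: (leP (- M) y) => h4; apply/andP; split; lra.
Qed.

Lemma clip_residual (M x : R) : 0 <= M -> `|x - clip M x| <= `|x|.
Proof.
move=> M0; rewrite /clip; case: (leP M x) => h1.
  by rewrite max_r; [rewrite !ger0_norm; lra|lra].
case: (leP (- M) x) => h2; first by rewrite subrr normr0.
by rewrite !ler0_norm; lra.
Qed.

Lemma continuous_clip M f : continuous f -> continuous (fun x => clip M (f x)).
Proof.
move=> cf x; apply: (@continuous_max _ _ (cst (- M)) (fun y => Num.min M (f y))).
  exact: cvg_cst.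
by apply: (@continuous_min _ _ (cst M) f); [exact: cvg_cst|exact: cf].
Qed.

Lemma measurable_clip (D : set R) (M : R) f : measurable_fun D f ->
  measurable_fun D (fun x => clip M (f x)).
Proof.
move=> mf; apply: measurable_maxr; first exact: measurable_cst.
by apply: measurable_minr => //; exact: measurable_cst.
Qed.

Section fixed_exponent.
Variables (p : R) (hp : 1 < p).
Let p0 : 0 < p. Proof. exact: lt_trans hp. Qed.

(** Dominated convergence, when the level M tends to infinity and the margin d
    at both ends tends to 0. *)
Lemma energy_truncation v (s T e : R) : 0 < s -> s < T ->
  measurable_fun half_line v -> (energy p `]s, T[ v < +oo)%E -> 0 < e ->
  exists M d : R, [/\ 0 <= M, 0 < d & (energy p `]s, T[
    (v \- ((fun x => clip M (v x)) \_ `[(s + d), (T - d)]))%R < e%:E)%E].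
Proof.
move=> s0 sT mv Ev e0.
have sub : `]s, T[ `<=` (half_line : set R).
  by apply: subset_trans (@segment_half_line R s T s0); exact: subset_itv_oo_cc.
have mvD : measurable_fun `]s, T[ v by exact: measurable_sub_half_line mv.
pose d n : R := n.+1%:R^-1.
have d0 n : 0 < d n by rewrite invr_gt0.
pose w n := (fun x => clip n.+1%:R (v x)) \_ `[(s + d n), (T - d n)].
have mw n : measurable_fun `]s, T[ (w n).
  apply: (measurable_restrict _ _ _).1 => //.
  by apply: measurable_clip; apply: measurable_funS mvD => // x [].
have mvw n : measurable_fun `]s, T[ (v \- w n) by exact: measurable_funB.
have res n x : `|v x - w n x| <= `|v x|.
  by rewrite /w patchE; case: ifPn => _; [exact: clip_residual|rewrite subr0].
have ivp : mu.-integrable `]s, T[ (fun x => (`|v x| `^ p * x `^ (p - 1))%:E).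
  apply: lebesgue_fin_num_integrable => //; first exact: measurable_energy_density.
  rewrite ge0_fin_numE//.
  by apply: integral_ge0 => x _; rewrite lee_fin energy_density_ge0.
have cv : energy p `]s, T[ (v \- w n) @[n --> \oo] --> (\int[mu]_(x in `]s, T[) (cst 0 x))%E.
  apply: lebesgue_dominated_cvg ivp _ => //.
  - by move=> n; apply/measurable_EFinP; exact: measurable_energy_density.
  - apply: aeW => x /=; rewrite in_itv/= => /andP[sx xT]; apply: cvg_near_cst.
    have sx0 : 0 < x - s by rewrite subr_gt0.
    have xT0 : 0 < T - x by rewrite subr_gt0.
    near=> n.
    have dx : d n < x - s by near: n; have := near_infty_natSinv_lt (PosNum sx0).
    have dT : d n < T - x by near: n; have := near_infty_natSinv_lt (PosNum xT0).
    rewrite /w patchE ifT; last by rewrite inE/= in_itv/=; apply/andP; split; lra.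
    rewrite clip_id ?subrr ?normr0 ?powR0 ?mul0r ?gt_eqF//.
    near: n; have := @nbhs_infty_gtr R `|v x|; apply: filterS => m xm.
    by apply: le_trans (ltW xm) _; rewrite ler_nat; apply: leqW.
  - apply: aeW => x n _; rewrite gee0_abs ?lee_fin ?energy_density_ge0//.
    rewrite ler_wpM2r ?powR_ge0//; apply: ge0_ler_powR; rewrite ?nnegrE ?(ltW p0)//.
    exact: res.
rewrite integral0 in cv.
move/fine_cvgP : cv => [fin1 /cvgrPdist_lt /(_ _ e0) H].
near \oo => n.
exists n.+1%:R, (d n); split => //; rewrite -/(w n).
have F : energy p `]s, T[ (v \- w n) \is a fin_num by near: n.
have B : `|0 - fine (energy p `]s, T[ (v \- w n))| < e by near: n.
rewrite -(fineK F) lte_fin.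
by move: B; rewrite sub0r normrN; apply: le_lt_trans; exact: ler_norm.
Unshelve. all: end_near. Qed.

(** A continuous h close to w in L^1, then a smooth f uniformly close to h, then
    the plateau times f.  Where the plateau is not 1, w vanishes, so the last
    step costs no more than |w - h| + eta. *)
Lemma smooth_energy_dense_bounded w (s T M d e : R) : 0 < s -> s < T -> 0 <= M -> 0 < d -> 0 < e ->
  measurable_fun `]s, T[ w -> (forall x, `|w x| <= M) ->
  (forall x, ~~ (s + d <= x <= T - d) -> w x = 0) ->
  exists psi, [/\ smooth psi, (forall x, (x <= s) || (T <= x) -> psi x = 0) &
    (energy p `]s, T[ (w \- psi)%R <= e%:E)%E].
Proof.
move=> s0 sT M0 d0 e0 mw wM w0.
pose C := (2 * M + 1) `^ (p - 1) * T `^ (p - 1).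
have T0 : 0 < T by exact: lt_trans sT.
have C0 : 0 < C by rewrite mulr_gt0// powR_gt0//; lra.
pose K := C * (1 + (T - s)).
have K0 : 0 < K by rewrite mulr_gt0//; lra.
(* eta <= 1 keeps |w - psi| below 2 M + 1 *)
pose eta := Num.min 1 (e / K).
have eta0 : 0 < eta by rewrite lt_min ltr01 divr_gt0.
have eta1 : eta <= 1 by rewrite ge_min lexx.
have etaK : K * eta <= e by rewrite mulrC -ler_pdivlMr// ge_min lexx orbT.
have muE : mu `]s, T[%classic = (T - s)%:E.
  by rewrite lebesgue_measure_itv/= lte_fin sT -EFinB.
have muf : (mu `]s, T[%classic < +oo)%E by rewrite muE ltry.
have iw : mu.-integrable `]s, T[ (EFin \o w).
  apply: measurable_bounded_integrable => //.
  by exists M; split; rewrite ?num_real// => y My x _; exact: le_trans (wM x) (ltW My).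
have [g_ [cg ig /fine_cvgP[fin1 /cvgrPdist_lt /(_ _ eta0) H]]] :=
  approximation_continuous_integrable (measurable_itv _) muf iw.
have [n [Fn Bn]] : exists n, (\int[mu]_(z in `]s, T[) `|(w z - g_ n z)%:E|)%E \is a fin_num /\
    `|0 - fine (\int[mu]_(z in `]s, T[) `|(w z - g_ n z)%:E|)%E| < eta.
  by near \oo => n; exists n; split; near: n.
pose g := g_ n.
have {Fn Bn} Ig : (\int[mu]_(z in `]s, T[) `|w z - g z|%:E <= eta%:E)%E.
  rewrite -(fineK Fn) lee_fin; move: Bn; rewrite sub0r normrN => /ltW.
  by apply: le_trans; exact: ler_norm.
pose h x := clip M (g x).
have ch : continuous h by apply: continuous_clip; exact: cg.
have [f sf fh] := smooth_uniform_approx ch (ltW sT) eta0.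
have hM x : `|h x| <= M by exact: clip_le.
have wh x : `|w x - h x| <= `|w x - g x|.
  by rewrite -{1}[w x](clip_id (wM x)); exact: clip_lip.
exists (plateau s T d \* f); split.
- by apply: smoothM; [exact: smooth_plateau|exact: sf].
- by move=> x xsT /=; rewrite plateau_out// mul0r.
have Hpt x : s < x < T -> `|w x - plateau s T d x * f x| <= `|w x - h x| + eta.
  move=> /andP[sx xT]; have fhx : `|h x - f x| <= eta by apply: fh; rewrite !ltW.
  have [xin|xout] := boolP (s + d <= x <= T - d).
    rewrite plateau_in// mul1r (_ : w x - f x = (w x - h x) + (h x - f x)); last by ring.
    by apply: le_trans (ler_normD _ _) _; rewrite lerD2l.
  rewrite w0// !sub0r !normrN normrM.
  have /andP[c0 c1] := plateau_itv s T d x.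
  rewrite (ger0_norm c0); apply: (@le_trans _ _ `|f x|); first exact: ler_piMl.
  rewrite (_ : f x = h x - (h x - f x)); last by ring.
  by apply: le_trans (ler_normB _ _) _; rewrite lerD2l.
have mg : measurable_fun `]s, T[ g by apply: continuous_measurableS => //; exact: cg.
have mwg : measurable_fun `]s, T[ (fun x => `|w x - g x|).
  by apply: measurableT_comp => //; exact: measurable_funB.
apply: (@le_trans _ _ (C%:E * \int[mu]_(x in `]s, T[) (`|w x - g x| + eta)%:E)%E).
  apply: energy_bounded_le => //.
  - apply: measurable_funB => //; apply: continuous_measurableS => //.
    by apply: smooth_continuous; apply: smoothM; [exact: smooth_plateau|exact: sf].
  - by apply: measurable_funD => //; exact: measurable_cst.
  - by move=> x xsT /=; apply: le_trans (Hpt x xsT) _; rewrite lerD2r.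
  - move=> x xsT /=; apply: le_trans (Hpt x xsT) _; apply: lerD => //.
    by apply: le_trans (ler_normB _ _) _; rewrite mulr2n mulrDl !mul1r lerD.
under eq_integral do rewrite EFinD.
rewrite ge0_integralD//; first last.
- by move=> x _; rewrite lee_fin ltW.
- exact/measurable_EFinP.
have -> : (\int[mu]_(x in `]s, T[) eta%:E = (eta * (T - s))%:E)%E.
  rewrite (@integral_cst _ _ _ mu _ (measurable_itv _)) EFinM; congr (_ * _)%E; exact: muE.
apply: (@le_trans _ _ (C%:E * (eta%:E + (eta * (T - s))%:E))%E).
  by rewrite lee_pmul2l// leeD2r.
rewrite -EFinD -EFinM lee_fin; apply: le_trans etaK.
by rewrite /K le_eqVlt; apply/orP; left; apply/eqP; ring.
Unshelve. all: end_near. Qed.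

Lemma smooth_energy_dense v (s T e : R) : 0 < s -> s < T -> 0 < e ->
  measurable_fun half_line v -> (energy p `]s, T[ v < +oo)%E ->
  exists psi, [/\ smooth psi, (forall x, (x <= s) || (T <= x) -> psi x = 0) &
    (energy p `]s, T[ (v \- psi)%R <= e%:E)%E].
Proof.
move=> s0 sT e0 mv Ev.
pose e1 := e / (2 `^ p * 2).
have P0 : 0 < 2 `^ p :> R by rewrite powR_gt0.
have e10 : 0 < e1 by rewrite divr_gt0// mulr_gt0.
have [M [d [M0 d0 Ew]]] := energy_truncation s0 sT mv Ev e10.
pose w := (fun x => clip M (v x)) \_ `[(s + d), (T - d)].
have sub : `]s, T[ `<=` (half_line : set R).
  by apply: subset_trans (@segment_half_line R s T s0); exact: subset_itv_oo_cc.
have mvD : measurable_fun `]s, T[ v by exact: measurable_sub_half_line mv.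
have mw : measurable_fun `]s, T[ w.
  apply: (measurable_restrict _ _ _).1 => //.
  by apply: measurable_clip; apply: measurable_funS mvD => // x [].
have wM x : `|w x| <= M.
  by rewrite /w patchE; case: ifPn => _; [exact: clip_le|rewrite normr0].
have w0 x : ~~ (s + d <= x <= T - d) -> w x = 0.
  by move=> xn; rewrite /w patchE ifF//; apply/negbTE; rewrite notin_setE/= in_itv/=; apply/negP.
have [psi [spsi psi0 Epsi]] := smooth_energy_dense_bounded s0 sT M0 d0 e10 mw wM w0.
exists psi; split => //.
have -> : v \- psi = (v \- w) \+ (w \- psi).
  by apply/funext => x /=; rewrite subrKA.
have mpsi : measurable_fun `]s, T[ psi.
  by apply: continuous_measurableS => //; exact: smooth_continuous.
apply: le_trans (energyD_le hp _ _ _) _ => //; [exact: measurable_funB|exact: measurable_funB|].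
apply: (@le_trans _ _ ((2 `^ p)%:E * (e1%:E + e1%:E))%E).
  apply: lee_wpmul2l; first by rewrite lee_fin ltW.
  by apply: leeD; [exact: ltW Ew|exact: Epsi].
rewrite -EFinD -EFinM lee_fin /e1 le_eqVlt; apply/orP; left; apply/eqP.
by field; rewrite gt_eqF.
Qed.

End fixed_exponent.

End density.

(** * The origin has zero capacity *)

Section capacity.
Context {R : realType}.
Implicit Types f : R -> R.

Section fixed_exponent.
Variables (p : R) (hp : 1 < p).
Let p0 : 0 < p. Proof. exact: lt_trans hp. Qed.

(** Ramps over the intervals [s / 2^(k+1), s / 2^k].  Their derivatives have
    disjoint supports, and their energies share the bound B because the energy of
    a derivative is scale-invariant. *)
Lemma dyadic_ramp_sum (s : R) : 0 < s -> exists2 B, 0 < B & forall n, exists f,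
  [/\ smooth f, forall x, 0 <= f x <= n%:R,
      forall x, s <= x -> f x = n%:R,
      forall x, x <= s / 2 ^+ n -> f x = 0 /\ derive1 f x = 0 &
      (forall x, s <= x -> derive1 f x = 0) /\
      (energy p half_line (derive1 f) <= (n%:R * B)%:E)%E].
Proof.
move=> s0; have [C C0 CP] := @derive1_ramp_bounded R.
exists (C `^ p * 2 `^ (p - 1)); first by rewrite mulr_gt0// powR_gt0.
elim=> [|n [f [sf f01 fs f0 [fs' Ef]]]].
  exists (cst 0); split => //.
  - exact: smooth_cst.
  - by move=> x; rewrite lexx.
  - by move=> x _; rewrite derive1_cst.
  - split => [x _|]; first by rewrite derive1_cst.
    rewrite mul0r /energy integral0_eq// => x _.
    by rewrite derive1_cst normr0 powR0 ?mul0r// gt_eqF.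
pose c := s / 2 ^+ n.+1.
have c0 : 0 < c by rewrite divr_gt0// exprn_gt0.
have cc : c + c = s / 2 ^+ n by rewrite /c exprS; field; rewrite expf_neq0.
have cs : c + c <= s by rewrite cc ler_pdivrMr ?exprn_gt0// ler_peMr ?(ltW s0)// exprn_ege1// ler1n.
have sr : smooth (ramp c c) by exact: smooth_ramp.
exists (f \+ ramp c c); split.
- exact: smoothD.
- move=> x /=; have /andP[a0 a1] := f01 x; have /andP[b0 b1] := ramp_itv c c x.
  by rewrite addr_ge0//= -natr1 lerD.
- by move=> x sx; rewrite /= fs// ramp1 ?natr1// (le_trans cs).
- move=> x xc; rewrite derive1D_smooth//=.
  have xc' : x <= s / 2 ^+ n by rewrite -cc (le_trans xc)// -/c lerDl ltW.
  have [-> ->] := f0 x xc'; rewrite !add0r ramp0//.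
  by rewrite derive1_ramp_out// xc.
split.
  move=> x sx; rewrite derive1D_smooth//= fs'// add0r derive1_ramp_out//.
  by rewrite (le_trans cs sx) orbT.
rewrite derive1D_smooth// energy_disjointD//; first last.
- move=> x; have [xc|/ltW cx] := leP x (c + c); first by left; apply: (f0 x _).2; rewrite -cc.
  by right; rewrite derive1_ramp_out// cx orbT.
- apply: smooth_measurable; [exact: measurable_half_line|exact: smooth_derive1].
- apply: smooth_measurable; [exact: measurable_half_line|exact: smooth_derive1].
- exact: measurable_half_line.
rewrite -natr1 mulrDl mul1r EFinD; apply: leeD => //.
have -> : energy p half_line (derive1 (ramp c c)) = energy p `[c, (c + c)%R] (derive1 (ramp c c)).
  apply: integral_support; first exact: segment_half_line.
  move=> x _ /= /negP; rewrite in_itv/= negb_and -!ltNge => xo.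
  rewrite derive1_ramp_out ?normr0 ?powR0 ?mul0r ?gt_eqF//.
  by case/orP: xo => /ltW ->; rewrite ?orbT.
have ccc : c <= c + c by rewrite lerDl ltW.
apply: le_trans (energy_le_cst hp (K := C / c) (b := c + c) (L := c) _ _ _ _ _) _.
- exact: measurable_itv.
- exact: segment_half_line.
- by apply: smooth_measurable; [exact: measurable_itv|exact: smooth_derive1].
- move=> x /=; rewrite in_itv/= => /andP[_ ->]; split => //; exact: CP.
- by rewrite (lebesgue_measure_segment ccc) addrK.
have -> : (C / c) `^ p * (c + c) `^ (p - 1) * c =
    C `^ p * 2 `^ (p - 1) * ((c^-1) `^ p * (c * c `^ (p - 1))).
  have -> : c + c = 2 * c by ring.
  rewrite (powRM _ (ltW C0)) ?invr_ge0 ?(ltW c0)// (powRM _ (ler0n _ 2) (ltW c0)).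
  by ring.
rewrite (mulr_powRB1 (ltW c0) p0) -powRM ?invr_ge0 ?(ltW c0)//.
by rewrite mulVf ?gt_eqF// powR1 mulr1.
Qed.

(** [dyadic_ramp_sum] divided by n has energy at most n^(1-p) B. *)
Lemma zero_capacity (s e : R) : 0 < s -> 0 < e -> exists f a,
  [/\ smooth f, forall x, 0 <= f x <= 1, forall x, s <= x -> f x = 1 /\ derive1 f x = 0,
      0 < a /\ (forall x, x <= a -> f x = 0) &
      (energy p half_line (derive1 f) <= e%:E)%E].
Proof.
move=> s0 e0; have [B B0 HB] := dyadic_ramp_sum s0.
have q0 : 0 < p - 1 by rewrite subr_gt0.
(* n is such that B <= e (n + 1)^(p - 1) *)
have [n] : exists n : nat, (B / e) `^ (p - 1)^-1 < n.+1%:R.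
  near \oo => n; exists n.
  near: n; have := @nbhs_infty_gtr R ((B / e) `^ (p - 1)^-1); apply: filterS => m xm.
  by apply: lt_trans xm _; rewrite ltr_nat.
set N : R := n.+1%:R => HN.
have N0 : 0 < N by rewrite ltr0n.
have NB : B <= e * N `^ (p - 1).
  rewrite mulrC -ler_pdivrMr//.
  have -> : B / e = ((B / e) `^ (p - 1)^-1) `^ (p - 1).
    by rewrite -powRrM mulVf ?gt_eqF// powRr1// divr_ge0 ?ltW.
  by apply: ge0_ler_powR; rewrite ?nnegrE ?powR_ge0 ?(ltW q0) ?(ltW N0) ?(ltW HN).
have [f [sf f01 fs f0 [fs' Ef]]] := HB n.+1.
have sc : smooth (cst N^-1 : R -> R) by exact: smooth_cst.
exists (cst N^-1 \* f), (s / 2 ^+ n.+1); split.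
- exact: smoothM.
- move=> x /=; have /andP[a0 a1] := f01 x.
  by rewrite mulr_ge0 ?invr_ge0 ?(ltW N0)//= mulrC ler_pdivrMr// mul1r.
- move=> x sx; rewrite derive1Z_smooth//= fs// fs'// mulr0; split => //.
  by rewrite mulVf// gt_eqF.
- split; first by rewrite divr_gt0// exprn_gt0.
  by move=> x xa /=; rewrite (f0 x xa).1 mulr0.
rewrite derive1Z_smooth// energyZ; last first.
- apply: smooth_measurable; [exact: measurable_half_line|exact: smooth_derive1].
- exact: measurable_half_line.
apply: (@le_trans _ _ ((`|N^-1| `^ p)%:E * (N * B)%:E)%E).
  by apply: lee_wpmul2l => //; rewrite lee_fin powR_ge0.
rewrite -EFinM lee_fin gtr0_norm ?invr_gt0// mulrA.
have -> : N^-1 `^ p * N = (N `^ (p - 1))^-1.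
  rewrite -powR_inv1 ?(ltW N0)// -powRrM mulN1r -[X in _ * X](powRr1 (ltW N0)).
  rewrite -powRD; last by rewrite (gt_eqF N0) implybT.
  by rewrite -powRN; congr (_ `^ _); ring.
by rewrite mulrC ler_pdivrMr ?powR_gt0.
Unshelve. all: end_near. Qed.

End fixed_exponent.

End capacity.

(** * Approximation by test functions *)

Section approximation.
Context {R : realType}.
Local Notation mu := (@lebesgue_measure R).
Implicit Types f g u v w : R -> R.

(** phi is the product of f, of g and of a ramp descending from 1 to 0 over
    [T, 2T]; at each point at most one of the three factors is not locally
    constant. *)
Lemma cutoff_glue f g (c s T b C : R) : 0 < s -> s < T -> 0 < b ->
  (forall c d x : R, 0 < d -> `|derive1 (ramp c d) x| <= C / d) ->
  smooth f -> (forall x, x <= s -> f x = c) ->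
  (forall x, x <= s \/ T <= x -> derive1 f x = 0) ->
  smooth g -> (forall x, s <= x -> g x = 1 /\ derive1 g x = 0) ->
  (forall x, x <= b -> g x = 0) ->
  exists phi, [/\ test_function phi,
    forall x, x <= s -> phi x = c * g x /\ derive1 phi x = c * derive1 g x,
    forall x, s <= x -> x <= T -> phi x = f x /\ derive1 phi x = derive1 f x,
    forall x, T <= x -> `|phi x| <= `|f T| /\ `|derive1 phi x| <= `|f T| * (C / T) &
    forall x, T + T < x -> phi x = 0 /\ derive1 phi x = 0].
Proof.
move=> s0 sT b0 CP sf fs f0' sg g1 gb.
have T0 : 0 < T by exact: lt_trans sT.
pose r := ramp T T.
have sr : smooth r by exact: smooth_ramp.
have sm1 : smooth (cst (- 1) : R -> R) by exact: smooth_cst.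
have s1 : smooth (cst 1 : R -> R) by exact: smooth_cst.
have smr := smoothM sm1 sr.
pose h := cst 1 \+ (cst (-1) \* r).
have sh : smooth h := smoothD s1 smr.
have hE x : h x = 1 - r x by rewrite /h/= mulN1r.
have h' x : derive1 h x = - derive1 r x.
  by rewrite /h (derive1D_smooth s1 smr)/= (derive1Z_smooth _ sr)/= derive1_cst add0r mulN1r.
have sgh := smoothM sg sh.
pose phi := f \* (g \* h).
have sphi : smooth phi := smoothM sf sgh.
have phi' x : derive1 phi x = f x * (g x * derive1 h x + h x * derive1 g x) + g x * h x * derive1 f x.
  by rewrite /phi (derive1M_smooth sf sgh) (derive1M_smooth sg sh).
have hT x : x <= T -> h x = 1 /\ derive1 h x = 0.
  by move=> xT; rewrite hE h' /r ramp0// derive1_ramp_out ?xT// subr0 oppr0.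
have fT x : T <= x -> f x = f T.
  by move=> Tx; apply: smooth_eq0_derive1 => // y Ty; apply: f0'; right.
have phiL x : x <= s -> phi x = c * g x /\ derive1 phi x = c * derive1 g x.
  move=> xs; have [h1 h0] := hT x (le_trans xs (ltW sT)).
  by rewrite phi' /phi/= h1 h0 fs// f0'; [rewrite !mulr0 !mulr1 mul1r add0r addr0|left].
have phiM x : s <= x -> x <= T -> phi x = f x /\ derive1 phi x = derive1 f x.
  move=> sx xT; have [h1 h0] := hT x xT; have [g1' g0'] := g1 x sx.
  by rewrite phi' /phi/= h1 h0 g1' g0' !mulr0 addr0 mulr0 add0r !mulr1 mul1r.
have phiR x : T <= x -> phi x = f T * h x /\ derive1 phi x = f T * derive1 h x.
  move=> Tx; have [g1' g0'] := g1 x (le_trans (ltW sT) Tx).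
  by rewrite phi' /phi/= g1' g0' fT// f0'; [rewrite !mulr0 !mul1r !addr0|right].
have TT : T <= T + T by rewrite lerDl ltW.
have phi0 x : T + T < x -> phi x = 0 /\ derive1 phi x = 0.
  move=> Tx; have [-> ->] := phiR x (le_trans TT (ltW Tx)).
  by rewrite hE h' /r ramp1 ?(ltW Tx)// derive1_ramp_out ?(ltW Tx) ?orbT// subrr oppr0 mulr0.
exists phi; split.
- apply: (@test_function_itv R phi b (T + T)); [exact: sphi|exact: b0|].
  move=> x; apply: contraNT; rewrite negb_and -!ltNge => /orP[xb|/phi0[-> _]//].
  by rewrite /phi/= gb ?(ltW xb)// mul0r mulr0.
- exact: phiL.
- exact: phiM.
- move=> x Tx; have [-> ->] := phiR x Tx; rewrite !normrM h' normrN.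
  have /andP[r0 r1] := ramp_itv T T x; split; last by rewrite ler_wpM2l//; exact: CP.
  by rewrite ler_piMr// hE ger0_norm ?subr_ge0// lerBlDr lerDl.
- exact: phi0.
Qed.

Section fixed_exponent.
Variables (p : R) (hp : 1 < p).
Let p0 : 0 < p. Proof. exact: lt_trans hp. Qed.

(** f is u s plus the primitive of a smooth function close to v in energy;
    [integral_norm_energy] turns this closeness into uniform closeness of f
    to u. *)
Lemma inner_approximation u v (s T k e : R) : 0 < s -> s < T -> 0 < k -> 0 < e ->
  {within half_line, continuous u} -> weak_derivative u v ->
  (energy p half_line v < +oo)%E ->
  exists f, [/\ smooth f, forall x, x <= s -> f x = u s,
    forall x, x <= s \/ T <= x -> derive1 f x = 0,
    forall x, s <= x <= T -> `|u x - f x| <= k &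
    (energy p `]s, T[ (v \- derive1 f)%R <= e%:E)%E].
Proof.
move=> s0 sT k0 e0 cu uv Ev; have lv := uv.1.
have mv := locally_integrable_measurable lv.
have T0 : 0 < T by exact: lt_trans sT.
have sub : `]s, T[ `<=` (half_line : set R).
  by apply: subset_trans (@segment_half_line R s T s0); exact: subset_itv_oo_cc.
(* d and e1 make each of the two terms of [integral_norm_energy] at most
   s k / 2 *)
pose d := s * k / (2 * T).
have d0 : 0 < d by rewrite divr_gt0// mulr_gt0.
pose e1 := Num.min e (s * k / (2 * (T * d `^ (1 - p)))).
have e10 : 0 < e1 by rewrite lt_min e0 divr_gt0// ?mulr_gt0// powR_gt0.
have Ev' : (energy p `]s, T[ v < +oo)%E.
  apply: le_lt_trans Ev; apply: energy_subset => //; exact: measurable_half_line.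
have [psi [spsi psi0 Epsi]] := smooth_energy_dense hp s0 sT e10 mv Ev'.
have psis x : x <= s -> psi x = 0 by move=> xs; rewrite psi0// xs.
have [F [sF dF F0]] := smooth_primitive spsi psis.
have sc : smooth (cst (u s) : R -> R) by exact: smooth_cst.
have sf := smoothD sc sF.
have df : derive1 (cst (u s) \+ F) = psi.
  by rewrite (derive1D_smooth sc sF) dF; apply/funext => x; rewrite /= derive1_cst add0r.
exists (cst (u s) \+ F); split.
- exact: sf.
- by move=> x xs; rewrite /= F0// addr0.
- by move=> x [xs|Tx]; rewrite df psi0// ?xs ?Tx ?orbT.
- move=> x /andP[sx xT]; have [->|sx'] := eqVneq x s.
    by rewrite /= F0// addr0 subrr normr0 ltW.
  have {}sx : s < x by rewrite lt_neqAle eq_sym sx'.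
  have lpsi : locally_integrable half_line psi.
    apply: half_line_continuous_locally_integrable; apply: continuous_subspaceT => y.
    exact: smooth_continuous.
  have lvp : locally_integrable half_line (v \- psi) by exact: locally_integrableB.
  have mvp := locally_integrable_measurable lvp.
  have ivp := @locally_integrable_segment R _ s x s0 lvp.
  have Du : u x - (cst (u s) \+ F) x = \int[mu]_(y in `[s, x]) (v y - psi y).
    rewrite RintegralB//; [|exact: locally_integrable_segment lv|exact: locally_integrable_segment lpsi].
    rewrite -(weak_derivative_ftc cu uv s0 sx) -dF.
    have -> : \int[mu]_(y in `[s, x]) derive1 F y = F x.
      by rewrite /Rintegral (integral_derive1_smooth sF sx)/= (F0 s)// subr0.
    by rewrite /= opprD addrA.
  rewrite Du; apply: le_trans (le_normr_Rintegral _ ivp) _ => //.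
  have E1 : (energy p `[s, x] (v \- psi)%R <= e1%:E)%E.
    apply: le_trans Epsi; rewrite energy_oo_cc; last first.
      apply: measurable_sub_half_line mvp; apply: subset_trans sub.
      by apply: subset_itvl; rewrite bnd_simp.
    apply: energy_subset => //; first exact: measurable_sub_half_line mvp.
    by apply: subset_itvl; rewrite bnd_simp.
  have I := integral_norm_energy hp s0 sx d0 lvp E1.
  rewrite -(ler_pM2l s0); apply: le_trans I _.
  have D0 : 0 < d `^ (1 - p) by exact: powR_gt0.
  have b1 : x * d `^ (1 - p) * e1 <= s * k / 2.
    apply: (@le_trans _ _ (T * d `^ (1 - p) * e1)).
      by rewrite ler_wpM2r ?(ltW e10)// ler_wpM2r ?(ltW D0).
    rewrite mulrC -ler_pdivlMr ?mulr_gt0//.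
    apply: (@le_trans _ _ (s * k / (2 * (T * d `^ (1 - p))))).
      by rewrite /e1 ge_min lexx orbT.
    by rewrite le_eqVlt; apply/orP; left; apply/eqP; field; rewrite !gt_eqF.
  have b2 : d * (x - s) <= s * k / 2.
    apply: (@le_trans _ _ (d * T)); first by rewrite ler_wpM2l ?(ltW d0)//; lra.
    by rewrite le_eqVlt; apply/orP; left; apply/eqP; rewrite /d; field; rewrite !gt_eqF.
  by apply: le_trans (lerD b1 b2) _; rewrite -splitr.
- by rewrite df; apply: le_trans Epsi _; rewrite lee_fin ge_min lexx.
Qed.

(** The half-line is split at s and T.  On each of the outer pieces u, v and the
    approximation have small energies separately; on ]s, T[ the approximation
    is close. *)
Lemma test_function_approximation u v : {within half_line, continuous u} ->
  weak_derivative u v -> (energy p half_line u < +oo)%E -> (energy p half_line v < +oo)%E ->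
  forall e, 0 < e -> exists phi, [/\ test_function phi,
    (energy p half_line (u \- phi)%R <= e%:E)%E &
    (energy p half_line (v \- derive1 phi)%R <= e%:E)%E].
Proof.
move=> cu uv Eu Ev e e0; have lv := uv.1.
have mu_ := half_line_continuous_measurable cu.
have mv := locally_integrable_measurable lv.
have [C C0 CP] := @derive1_ramp_bounded R.
pose P : R := 2 `^ p.
have P0 : 0 < P by exact: powR_gt0.
(* Q d bounds the sum of the energies over the three pieces, for u and for v *)
pose Q := 4 * P + 1 + 3 * P ^+ 3 * (1 + C `^ p).
have CP0 : 0 <= C `^ p by exact: powR_ge0.
have P3 : 0 < P ^+ 3 by exact: exprn_gt0.
have Q0 : 0 < Q by rewrite /Q; nra.
pose d := e / Q.
have d0 : 0 < d by rewrite divr_gt0.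
have eQ : e = Q * d by rewrite /d mulrC divfK// gt_eqF.
clearbody d.
have [N1 N11 HN1] := energy_tail d0 mu_ Eu.
have [N2 N21 HN2] := energy_tail d0 mv Ev.
pose N := N1 + N2.
have N0 : 0 < N by rewrite /N; lra.
have NV1 x : x < N^-1 -> x < N1^-1.
  by move=> /lt_le_trans; apply; rewrite lef_pV2 ?posrE /N//; lra.
have NV2 x : x < N^-1 -> x < N2^-1.
  by move=> /lt_le_trans; apply; rewrite lef_pV2 ?posrE /N//; lra.
have outN (A : set R) : measurable A -> A `<=` half_line -> (forall x, A x -> x < N^-1 \/ N < x) ->
    (energy p A u < d%:E)%E /\ (energy p A v < d%:E)%E.
  move=> mA AH HA; split; [apply: HN1 => // x /HA[]|apply: HN2 => // x /HA[]].
  - by move=> /NV1; left.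
  - by move=> xN; right; move: xN; rewrite /N; lra.
  - by move=> /NV2; left.
  - by move=> xN; right; move: xN; rewrite /N; lra.
(* s and T are taken in dyadic windows lying in the tails, where u s and u T
   are small relative to the scale *)
pose a := N^-1 / 4.
have NV0 : 0 < N^-1 by rewrite invr_gt0.
have a0 : 0 < a by rewrite divr_gt0.
have d2 : 2 * d / 2 = d by field.
have [s /andP[as_ sa] Hs] : exists2 s, a <= s <= 2 * a & `|u s| `^ p * s `^ p <= 2 * d.
  apply: energy_pick => //; rewrite d2.
  apply: (outN _ _ _ _).1 => //; first exact: segment_half_line.
  by move=> x /=; rewrite in_itv/= => /andP[_ xa]; left; move: xa; rewrite /a; lra.
have [T /andP[bT Tb] HT] : exists2 T, 2 * N <= T <= 2 * (2 * N) & `|u T| `^ p * T `^ p <= 2 * d.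
  apply: energy_pick => //; first lra; rewrite d2.
  apply: (outN _ _ _ _).1 => //; first by apply: segment_half_line; lra.
  by move=> x /=; rewrite in_itv/= => /andP[ax _]; right; lra.
have s0 : 0 < s by exact: lt_le_trans as_.
have N1' : 1 <= N by rewrite /N; lra.
have NV1' : N^-1 <= 1 by rewrite invf_le1.
have T1 : 1 <= T by apply: le_trans bT; move: N1'; lra.
have sT : s < T by move: sa; rewrite /a; lra.
have T0 : 0 < T by lra.
pose A1 : set R := `]0, s]%classic; pose A3 : set R := `[T, +oo[%classic.
have A1H : A1 `<=` half_line by move=> x; rewrite half_lineE /A1/= in_itv/= => /andP[].
have A3H : A3 `<=` half_line.
  by move=> x; rewrite half_lineE /A3/= in_itv/= andbT; exact: lt_le_trans.
have mA1 : measurable A1 by exact: measurable_itv.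
have mA3 : measurable A3 by exact: measurable_itv.
have [u1 v1] : (energy p A1 u < d%:E)%E /\ (energy p A1 v < d%:E)%E.
  apply: outN => // x; rewrite /A1/= in_itv/= => /andP[_ xs]; left.
  by apply: (le_lt_trans xs); move: sa; rewrite /a; lra.
have [u3 v3] : (energy p A3 u < d%:E)%E /\ (energy p A3 v < d%:E)%E.
  by apply: outN => // x; rewrite /A3/= in_itv/= andbT => Tx; right; lra.
(* k is small enough for T, so that a uniform error k on [s, T] has energy at
   most d *)
pose k := d `^ p^-1 / T.
have k0 : 0 < k by rewrite divr_gt0// powR_gt0.
have kT : k `^ p * T `^ p = d.
  rewrite -powRM ?(ltW k0) ?(ltW T0)// /k divfK ?gt_eqF// -powRrM mulVf ?gt_eqF//.
  by rewrite powRr1// ltW.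
clearbody k.
have [f [sf fs f0' fk Ef]] := inner_approximation s0 sT k0 d0 cu uv Ev.
(* the rising cutoff is chosen after u s, which may be large *)
pose e1 := d / (`|u s| `^ p + 1).
have us0 : 0 <= `|u s| `^ p by exact: powR_ge0.
have e10 : 0 < e1 by rewrite divr_gt0//; lra.
have e1d : `|u s| `^ p * e1 <= d.
  rewrite /e1 mulrCA; apply: ler_piMr; first exact: ltW.
  by rewrite ler_pdivrMr ?ltr_wpDl// mul1r lerDl.
clearbody e1.
have [g [b [sg g01 g1 [b0 gb] Eg]]] := zero_capacity hp s0 e10.
have [phi [tphi phiL phiM phiR phi0]] := cutoff_glue s0 sT b0 CP sf fs f0' sg g1 gb.
have sphi : smooth phi by case: tphi.
have TT : T <= T + T by rewrite lerDl ltW.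
have mH := @measurable_half_line R.
have mphi : measurable_fun half_line phi by exact: smooth_measurable.
have sphi' := smooth_derive1 sphi.
have mphi' : measurable_fun half_line (derive1 phi) by exact: smooth_measurable.
have rst (A : set R) w : A `<=` half_line -> measurable_fun half_line w -> measurable_fun A w.
  exact: measurable_sub_half_line.
(* f T differs from u T by at most k *)
have cTT : `|f T| `^ p * T `^ p <= 3 * P * d.
  rewrite (_ : f T = u T + - (u T - f T)); last by ring.
  apply: (@le_trans _ _ (P * (`|u T| `^ p + `|- (u T - f T)| `^ p) * T `^ p)).
    by rewrite ler_wpM2r ?powR_ge0//; exact: powR_normD_le.
  rewrite normrN (_ : 3 * P * d = P * (2 * d + d)); last by ring.
  rewrite -mulrA ler_wpM2l ?(ltW P0)// mulrDl; apply: lerD => //.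
  rewrite -kT ler_wpM2r ?powR_ge0//; apply: ge0_ler_powR; rewrite ?nnegrE ?(ltW p0) ?(ltW k0)//.
  by apply: fk; rewrite (ltW sT) lexx.
have cT1 : `|f T| `^ p <= 3 * P * d.
  apply: le_trans cTT; rewrite ler_peMr ?powR_ge0//.
  by rewrite -[leLHS](powRr0 T) ler_powR ?(ltW p0).
have TP : (T + T) `^ (p - 1) * T <= P * T `^ p.
  rewrite -(mulr_powRB1 (ltW T0) p0) mulrC mulrCA ler_wpM2l ?(ltW T0)//.
  rewrite (_ : T + T = 2 * T); last by ring.
  rewrite powRM ?(ltW T0)// ler_wpM2r ?powR_ge0//.
  by apply: ler_powR; rewrite ?ler1n// lerBlDr lerDl.
have tailE w : measurable_fun half_line w -> (forall x, T + T < x -> w x = 0) ->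
    energy p A3 w = energy p `[T, (T + T)%R] w.
  move=> mw w0; apply: integral_support; first by apply: subset_itvl; rewrite bnd_simp.
  move=> x; rewrite /A3/= !in_itv/= andbT => -> /negP /=; rewrite -ltNge => /w0 ->.
  by rewrite normr0 powR0 ?mul0r// gt_eqF.
have sTT : `[T, (T + T)%R] `<=` half_line by exact: segment_half_line.
have lTT : mu `[T, T + T]%classic = T%:E by rewrite lebesgue_measure_segment// addrK.
have Ephi3 : (energy p A3 phi <= (3 * P ^+ 2 * d)%:E)%E.
  rewrite tailE//; last by move=> x /phi0[].
  apply: le_trans (energy_le_cst hp (K := `|f T|) (b := T + T) (L := T) _ sTT _ _ lTT) _ => //.
  - exact: rst mphi.
  - move=> x /=; rewrite in_itv/= => /andP[Tx xT]; split => //.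
    by have [] := phiR x Tx.
  rewrite lee_fin -mulrA; apply: (@le_trans _ _ (`|f T| `^ p * (P * T `^ p))).
    by rewrite ler_wpM2l ?powR_ge0.
  rewrite mulrCA (_ : 3 * P ^+ 2 * d = P * (3 * P * d)); last by ring.
  by rewrite ler_wpM2l ?(ltW P0).
have Ephi'3 : (energy p A3 (derive1 phi) <= (3 * P ^+ 2 * C `^ p * d)%:E)%E.
  rewrite tailE//; last by move=> x /phi0[].
  apply: le_trans (energy_le_cst hp (K := `|f T| * (C / T)) (b := T + T) (L := T) _ sTT _ _ lTT) _ => //.
  - exact: rst mphi'.
  - move=> x /=; rewrite in_itv/= => /andP[Tx xT]; split => //.
    by have [] := phiR x Tx.
  rewrite lee_fin -mulrA.
  apply: (@le_trans _ _ ((`|f T| * (C / T)) `^ p * (P * T `^ p))).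
    by rewrite ler_wpM2l ?powR_ge0.
  have -> : (`|f T| * (C / T)) `^ p * (P * T `^ p) = (P * C `^ p) * `|f T| `^ p.
    rewrite mulrCA -powRM ?mulr_ge0 ?invr_ge0 ?(ltW C0) ?(ltW T0)//.
    rewrite (_ : `|f T| * (C / T) * T = C * `|f T|); last by field; rewrite gt_eqF.
    by rewrite powRM ?(ltW C0)// mulrA.
  rewrite (_ : 3 * P ^+ 2 * C `^ p * d = (P * C `^ p) * (3 * P * d)); last by ring.
  by rewrite ler_wpM2l ?mulr_ge0 ?(ltW P0).
exists phi; split; first exact: tphi.
- apply: le_trans (energy_split3 (s := s) (T := T) (a := P * (d + 2 * d)) (b := d)
    (c := P * (d + 3 * P ^+ 2 * d)) s0 sT _ _ _ _) _.
  + exact: measurable_funB.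
  + apply: (energyB_le hp); [exact: mA1|exact: rst mu_|exact: rst mphi|exact: ltW u1|].
    have lA1 : mu A1 = s%:E by rewrite /A1 lebesgue_measure_itv/= lte_fin s0 -EFinB subr0.
    apply: le_trans (energy_le_cst hp (K := `|u s|) (b := s) (L := s) _ A1H _ _ lA1) _ => //.
    * exact: rst mphi.
    * move=> x; rewrite /A1/= in_itv/= => /andP[x0 xs]; split => //.
      have [-> _] := phiL x xs; rewrite normrM ler_piMr//.
      by have /andP[g0 gx1] := g01 x; rewrite ger0_norm.
    rewrite lee_fin -mulrA (mulrC _ s) mulr_powRB1 ?(ltW s0)//.
  + have E : energy p `]s, T[ (u \- phi) = energy p `]s, T[ (u \- f).
      apply: eq_integral => x; rewrite inE/= in_itv/= => /andP[sx xT].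
      by rewrite (phiM x (ltW sx) (ltW xT)).1.
    have lA2 : mu `]s, T[%classic = (T - s)%:E by rewrite lebesgue_measure_itv/= lte_fin sT -EFinB.
    have A2H : `]s, T[ `<=` half_line.
      by apply: subset_trans (@segment_half_line R s T s0); exact: subset_itv_oo_cc.
    have mf : measurable_fun half_line f by apply: smooth_measurable; [exact: mH|exact: sf].
    rewrite E; apply: le_trans (energy_le_cst hp (K := k) (b := T) (L := T - s) _ A2H _ _ lA2) _.
    * exact: measurable_itv.
    * by apply: rst A2H _; exact: measurable_funB.
    * move=> x /=; rewrite in_itv/= => /andP[sx xT]; split; last exact: ltW.
      by apply: fk; rewrite !ltW.
    rewrite lee_fin -kT -mulrA; apply: ler_wpM2l; first exact: powR_ge0.
    rewrite -(mulr_powRB1 (ltW T0) p0) mulrC; apply: ler_wpM2r; first exact: powR_ge0.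
    by rewrite gerBl ltW.
  + by apply: (energyB_le hp); [exact: mA3|exact: rst mu_|exact: rst mphi|exact: ltW u3|exact: Ephi3].
  rewrite lee_fin eQ.
  have -> : P * (d + 2 * d) + d + P * (d + 3 * P ^+ 2 * d) = (4 * P + 1 + 3 * P ^+ 3) * d by ring.
  apply: ler_wpM2r; first exact: ltW.
  rewrite /Q lerD2l; apply: ler_peMr; last by rewrite lerDl.
  by apply: mulr_ge0; [exact: ler0n|exact: ltW].
- apply: le_trans (energy_split3 (s := s) (T := T) (a := P * (d + d)) (b := d)
    (c := P * (d + 3 * P ^+ 2 * C `^ p * d)) s0 sT _ _ _ _) _.
  + exact: measurable_funB.
  + apply: (energyB_le hp); [exact: mA1|exact: rst mv|exact: rst mphi'|exact: ltW v1|].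
    have E : energy p A1 (derive1 phi) = energy p A1 (cst (u s) \* derive1 g).
      apply: eq_integral => x; rewrite inE /A1/= in_itv/= => /andP[_ xs].
      by rewrite (phiL x xs).2.
    have sg' := smooth_derive1 sg.
    have mg' : measurable_fun half_line (derive1 g) by exact: smooth_measurable.
    rewrite E energyZ; [|exact: mA1|exact: rst mg'].
    apply: (@le_trans _ _ ((`|u s| `^ p)%:E * e1%:E)%E).
      apply: lee_wpmul2l; first by rewrite lee_fin.
      by apply: le_trans Eg; exact: energy_subset.
    by rewrite -EFinM lee_fin.
  + have E : energy p `]s, T[ (v \- derive1 phi) = energy p `]s, T[ (v \- derive1 f).
      apply: eq_integral => x; rewrite inE/= in_itv/= => /andP[sx xT].
      by rewrite /= (phiM x (ltW sx) (ltW xT)).2.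
    by rewrite E.
  + by apply: (energyB_le hp); [exact: mA3|exact: rst mv|exact: rst mphi'|exact: ltW v3|exact: Ephi'3].
  rewrite lee_fin eQ.
  have -> : P * (d + d) + d + P * (d + 3 * P ^+ 2 * C `^ p * d) = (3 * P + 1 + 3 * P ^+ 3 * C `^ p) * d by ring.
  rewrite ler_wpM2r ?(ltW d0)// /Q.
  move: (C `^ p) (P ^+ 3) CP0 P3 => c q _; move: P0; clear; lra.
Qed.

End fixed_exponent.

End approximation.

(** * The double logarithm *)

Section loglog.
Context {R : realType}.
Local Notation mu := (@lebesgue_measure R).
Implicit Types h : R -> R.

(** Clipping at 1 keeps this at least 1 on all of R, so that [loglog] and
    [loglog_slope] are continuous on the half-line. *)
Definition clipped_log (x : R) : R := 1 - ln (Num.min x 1).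

Definition loglog (x : R) : R := ln (clipped_log x).

(** The derivative of [loglog] on ]0, 1[, continued beyond 1 without a jump. *)
Definition loglog_slope (x : R) : R := - (x * clipped_log x)^-1.

Definition loglog_deriv : R -> R := loglog_slope \_ `]-oo, 1[.

Lemma clipped_log_ge1 x : 1 <= clipped_log x.
Proof. by rewrite /clipped_log lerBrDl gerDr; apply: ln_le0; rewrite ge_min lexx orbT. Qed.

Lemma clipped_log_gt0 x : 0 < clipped_log x.
Proof. exact: lt_le_trans (clipped_log_ge1 x). Qed.

Lemma clipped_logE x : x <= 1 -> clipped_log x = 1 - ln x.
Proof. by move=> x1; rewrite /clipped_log min_l. Qed.

Lemma loglog_eq0 x : 1 <= x -> loglog x = 0.
Proof. by move=> x1; rewrite /loglog /clipped_log min_r// ln1 subr0 ln1. Qed.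

Lemma loglog_ge0 x : 0 <= loglog x.
Proof. exact/ln_ge0/clipped_log_ge1. Qed.

Lemma continuous_clipped_log x : 0 < x -> {for x, continuous clipped_log}.
Proof.
move=> x0; have hm : Num.min y 1 @[y --> x] --> Num.min x 1.
  by apply: (@continuous_min _ _ id (cst 1)) => //; exact: cvg_cst.
apply: cvgB; first exact: cvg_cst.
by apply: cvg_comp hm _; apply: continuous_ln; rewrite lt_min x0 ltr01.
Qed.

Lemma continuous_loglog x : 0 < x -> {for x, continuous loglog}.
Proof.
move=> x0; apply: continuous_comp; first exact: continuous_clipped_log.
exact/continuous_ln/clipped_log_gt0.
Qed.

Lemma continuous_loglog_slope x : 0 < x -> {for x, continuous loglog_slope}.
Proof.
move=> x0; apply: cvgN; apply: cvgV; first by rewrite mulf_neq0 ?gt_eqF ?clipped_log_gt0.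
by apply: cvgM; [exact: cvg_id|exact: continuous_clipped_log].
Qed.

Lemma is_derive_clipped_log (x : R) : 0 < x < 1 -> is_derive x 1 clipped_log (- x^-1).
Proof.
move=> /andP[x0 x1].
have nf : \forall y \near x, 1 - ln y = clipped_log y.
  have : \forall y \near x, y < 1 by exact: lt_nbhsl.
  by apply: filterS => y y1; rewrite clipped_logE// ltW.
apply: (near_eq_is_derive nf).
have h := is_deriveB (is_derive_cst (1 : R) x 1) (is_derive1_ln x0).
by apply: (is_derive1_eq h); rewrite sub0r.
Qed.

Lemma is_derive_loglog (x : R) : 0 < x < 1 -> is_derive x 1 loglog (loglog_slope x).
Proof.
move=> x01; have h1 := is_derive_clipped_log x01.
have h2 := is_derive1_ln (clipped_log_gt0 x).
have h := @is_derive1_comp _ (@ln R) clipped_log x _ _ h2 h1.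
apply: (is_derive1_eq h); rewrite /loglog_slope invfM mulrN; congr (- _).
by rewrite mulrC.
Qed.

Lemma loglog_derivE x : x < 1 -> loglog_deriv x = loglog_slope x.
Proof. by move=> x1; rewrite /loglog_deriv patchE ifT// inE/= in_itv/=. Qed.

Lemma loglog_deriv_out x : 1 <= x -> loglog_deriv x = 0.
Proof.
move=> x1; rewrite /loglog_deriv patchE ifF//; apply/negbTE.
by rewrite notin_setE/= in_itv/= => /lt_geF; rewrite x1.
Qed.

Lemma measurable_loglog_deriv : measurable_fun half_line loglog_deriv.
Proof.
apply: (measurable_restrict _ _ _).1 => //.
  exact: measurable_half_line.
apply: measurable_sub_half_line; first by move=> x [].
by apply: half_line_continuous_measurable; apply: half_line_continuous; exact: continuous_loglog_slope.
Qed.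

Lemma norm_loglog_deriv_le x : 0 < x -> `|loglog_deriv x| <= `|loglog_slope x|.
Proof. by move=> x0; rewrite /loglog_deriv patchE; case: ifPn; rewrite ?normr0. Qed.

Lemma locally_integrable_loglog_deriv : locally_integrable half_line loglog_deriv.
Proof.
have [ms oH ls] := half_line_continuous_locally_integrable (half_line_continuous continuous_loglog_slope).
split => // [|K KH cK]; first exact: measurable_loglog_deriv.
have mK : measurable K by exact: compact_measurable.
apply: le_lt_trans (ls K KH cK).
apply: (@lebesgue_ge0_le_integral R K (fun x => `|loglog_deriv x|) (fun x => `|loglog_slope x|)) => //.
- apply: measurableT_comp => //; apply: measurable_sub_half_line => //; exact: measurable_loglog_deriv.
- by apply: measurableT_comp => //; apply: measurable_sub_half_line.
by move=> x /KH; rewrite half_lineE => /norm_loglog_deriv_le.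
Qed.

Lemma weak_derivative_loglog : weak_derivative loglog loglog_deriv.
Proof.
split; first exact: locally_integrable_loglog_deriv.
move=> phi tphi; have [a [b [a0 ab Hphi]]] := test_function_supp tphi.
have sphi : smooth phi by case: tphi.
(* below c the test function vanishes, and beyond 1 both loglog and its
   derivative do *)
pose c := Num.min a 1 / 2.
have c0 : 0 < c by rewrite divr_gt0// lt_min a0 ltr01.
have ca : c < a.
  have : Num.min a 1 <= a by rewrite ge_min lexx.
  by move: c0; rewrite /c; lra.
have c1 : c < 1.
  have : Num.min a 1 <= 1 by rewrite ge_min lexx orbT.
  by move: c0; rewrite /c; lra.
have zc x : x <= c -> phi x = 0 /\ derive1 phi x = 0.
  by move=> xc; apply: Hphi; rewrite negb_and -!ltNge (le_lt_trans xc ca).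
have sub : `[c, 1] `<=` half_line by exact: segment_half_line.
have out (x : R) : half_line x -> ~ `[c, 1]%classic x -> x <= c \/ 1 < x.
  by move=> _ /= /negP; rewrite in_itv/= negb_and -!ltNge => /orP[/ltW|]; [left|right].
rewrite (@integral_support R `[c, 1])//; last first.
  move=> x xH /(out _ xH)[/zc[_ ->]|/ltW/loglog_eq0 ->]; by rewrite ?mulr0 ?mul0r.
rewrite [in RHS](@integral_support R `[c, 1])//; last first.
  move=> x xH /(out _ xH)[/zc[-> _]|x1]; first by rewrite mulr0.
  by rewrite loglog_deriv_out ?mul0r// ltW.
have cs : {within `[c, 1], continuous loglog_slope}.
  apply: half_line_segment_continuous => //; exact: half_line_continuous continuous_loglog_slope.
rewrite (@integration_by_parts R loglog phi loglog_slope (derive1 phi))//.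
- rewrite loglog_eq0// mul0r (zc c _).1// mulr0 subrr sub0e; congr (- _)%E.
  have mp (D : set R) : measurable D -> measurable_fun D phi.
    by move=> mD; apply: continuous_measurableS => //; exact: smooth_continuous.
  apply: (@eq_integral_itv_bounded R c 1 (fun x => loglog_deriv x * phi x) (fun x => loglog_slope x * phi x)).
  + apply: measurable_funM; last exact: mp.
    apply: (@measurable_sub_half_line R `]c, 1[); first by apply: subset_trans sub; exact: subset_itv_oo_cc.
    by apply: half_line_continuous_measurable; apply: half_line_continuous; exact: continuous_loglog_slope.
  + apply: measurable_funM; last exact: mp.
    apply: (@measurable_sub_half_line R `]c, 1[); first by apply: subset_trans sub; exact: subset_itv_oo_cc.
    exact: measurable_loglog_deriv.
  + move=> x; rewrite in_itv/= => /andP[_ x1]; by rewrite loglog_derivE.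
- split.
  + move=> x; rewrite in_itv/= => /andP[cx x1].
    by have [] := @is_derive_loglog x; first by rewrite x1 (lt_trans c0).
  + by apply: cvg_at_right_filter; exact: continuous_loglog.
  + by apply: cvg_at_left_filter; exact: continuous_loglog.
- move=> x; rewrite in_itv/= => /andP[cx x1]; rewrite derive1E.
  by have [] := @is_derive_loglog x; first by rewrite x1 (lt_trans c0).
- by apply: continuous_subspaceT => x; exact/smooth_continuous/smooth_derive1.
- exact: smooth_derivable_oo_LRcontinuous.
Qed.

Lemma loglog_unbounded (M : R) : exists2 c, 0 < c & forall x, 0 < x -> x <= c -> M <= loglog x.
Proof.
exists (expR (1 - expR `|M|)); first exact: expR_gt0.
move=> x x0 xc.
have e1 : 1 <= expR `|M| by rewrite (le_trans _ (expR_ge1Dx _))// lerDl.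
have x1 : x <= 1 by rewrite (le_trans xc)// -expR0 ler_expR; lra.
apply: le_trans (ler_norm M) _.
rewrite -ler_expR /loglog lnK ?posrE ?clipped_log_gt0// clipped_logE//.
have : ln x <= 1 - expR `|M| by rewrite -[leRHS]expRK ler_ln// posrE ?expR_gt0.
by lra.
Qed.

Lemma loglog_no_limit : ~ exists l : R, loglog t @[t --> 0^'+] --> l.
Proof.
move=> [l /cvgrPdist_lt /(_ 1 ltr01) H].
have [c c0 Hc] := loglog_unbounded (l + 1).
near (0 : R)^'+ => t.
have t0 : 0 < t by [].
have tc : t <= c by near: t; exact: nbhs_right_le.
have : `|l - loglog t| < 1 by near: t.
have := Hc t t0 tc; rewrite ltr_norml => lt /andP[]; lra.
Unshelve. all: end_near. Qed.

(** Monotone convergence along the segments [1/n, 1]. *)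
Lemma integral_at0_le h (M : \bar R) : measurable_fun half_line h ->
  (forall x, half_line x -> 0 <= h x) ->
  (forall c, 0 < c -> c < 1 -> (\int[mu]_(x in `[c, 1%R]) (h x)%:E <= M)%E) ->
  (\int[mu]_(x in `]0%R, 1%R]) (h x)%:E <= M)%E.
Proof.
move=> mh h0 hM.
pose F n : set R := `[n.+2%:R^-1, 1]%classic.
have F0 n : 0 < n.+2%:R^-1 :> R by rewrite invr_gt0.
have FH n : F n `<=` half_line by exact: segment_half_line.
have -> : `]0, 1]%classic = \bigcup_n F n.
  apply/seteqP; split => x /=; rewrite in_itv/=.
    move=> /andP[x0 x1]; near \oo => n; exists n => //; rewrite /F/= in_itv/= x1 andbT.
    apply: (@le_trans _ _ n.+1%:R^-1); first by rewrite lef_pV2 ?posrE// ler_nat.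
    by apply: ltW; near: n; have := near_infty_natSinv_lt (PosNum x0).
  by move=> [n _]; rewrite /F/= in_itv/= => /andP[nx ->]; rewrite (lt_le_trans (F0 n)).
have cv : (\int[mu]_(x in F n) (h x)%:E)%E @[n --> \oo] --> (\int[mu]_(x in \bigcup_n F n) (h x)%:E)%E.
  apply: ge0_nondecreasing_set_cvg_integral.
  - move=> n m nm; apply/subsetPset; apply: subset_itvr; rewrite bnd_simp.
    by rewrite lef_pV2 ?posrE// ler_nat.
  - by move=> n; exact: measurable_itv.
  - by move=> n; apply/measurable_EFinP; exact: measurable_sub_half_line mh.
  - by move=> n x /FH/h0; rewrite lee_fin.
have := cvg_lim (@ereal_hausdorff R) cv => <-.
apply: lime_le; first by apply/cvg_ex; eexists; exact: cv.
apply: nearW => n; apply: hM => //.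
by rewrite invf_lt1// ltr1n.
Unshelve. all: end_near. Qed.

Section fixed_exponent.
Variables (p : R) (hp : 1 < p).
Let p0 : 0 < p. Proof. exact: lt_trans hp. Qed.

(** log (1 + log (1/x)) <= log (1/x) <= x^-e / e, where e = (p - 1) / p makes
    the powers of x cancel. *)
Lemma loglog_energy_density_le x : 0 < x -> x <= 1 ->
  `|loglog x| `^ p * x `^ (p - 1) <= (p / (p - 1)) `^ p.
Proof.
move=> x0 x1; pose e := (p - 1) / p.
have e0 : 0 < e by rewrite divr_gt0// subr_gt0.
have -> : p / (p - 1) = e^-1 by rewrite /e invf_div.
have lx : loglog x <= x `^ (- e) / e.
  rewrite /loglog clipped_logE//; apply: (@le_trans _ _ (- ln x)).
    by apply: le_ln1Dx; rewrite ltrN2; apply: (@le_lt_trans _ _ 0); [exact: ln_le0|].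
  rewrite ler_pdivlMr//.
  have -> : - ln x * e = ln (x `^ (- e)) by rewrite ln_powR mulrC mulrN mulNr.
  by apply/ltW/ln_sublinear/powR_gt0.
have -> : x `^ (p - 1) = (x `^ e) `^ p.
  by rewrite -powRrM /e divfK// gt_eqF.
rewrite -powRM ?powR_ge0//; apply: ge0_ler_powR; rewrite ?nnegrE ?mulr_ge0 ?powR_ge0 ?invr_ge0 ?(ltW p0) ?(ltW e0)//.
rewrite ger0_norm ?loglog_ge0//.
apply: le_trans (ler_wpM2r _ lx) _; first exact: powR_ge0.
rewrite mulrAC -powRD; last by rewrite (gt_eqF x0) implybT.
by rewrite addNr powRr0 mul1r.
Qed.

Lemma energy_loglog : (energy p half_line loglog < +oo)%E.
Proof.
have ml := half_line_continuous_measurable (half_line_continuous continuous_loglog).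
rewrite /energy (@integral_support R `]0, 1]); first last.
- move=> x; rewrite half_lineE => x0 /= /negP; rewrite in_itv/= x0 /= -ltNge => /ltW x1.
  by rewrite loglog_eq0// normr0 powR0 ?mul0r// gt_eqF.
- by move=> x /=; rewrite in_itv/= half_lineE => /andP[].
apply: (@le_lt_trans _ _ (((p / (p - 1)) `^ p)%:E)); last exact: ltry.
apply: integral_at0_le.
- exact: measurable_energy_density.
- by move=> x _; exact: energy_density_ge0.
move=> c c0 c1; apply: (@le_trans _ _ (\int[mu]_(x in `[c, 1%R]) ((p / (p - 1)) `^ p)%:E)%E).
  apply: lebesgue_ge0_le_integral => //.
  - by move=> x _; exact: energy_density_ge0.
  - by apply: measurable_energy_density; apply: measurable_sub_half_line ml; exact: segment_half_line.
  move=> x /=; rewrite in_itv/= => /andP[cx x1].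
  by apply: loglog_energy_density_le => //; exact: lt_le_trans cx.
rewrite integral_segment_cst ?(ltW c1)// lee_fin ler_piMr ?powR_ge0//; lra.
Qed.

Lemma loglog_slope_energy_density x : 0 < x ->
  `|loglog_slope x| `^ p * x `^ (p - 1) = clipped_log x `^ (- p) / x.
Proof.
move=> x0; have L0 := clipped_log_gt0 x.
have xL : 0 < x * clipped_log x by rewrite mulr_gt0.
rewrite /loglog_slope normrN gtr0_norm ?invr_gt0//.
have -> : (x * clipped_log x)^-1 `^ p = x `^ (- p) * clipped_log x `^ (- p).
  rewrite -powR_inv1 ?(ltW xL)// -powRrM mulN1r powRM//; exact: ltW.
rewrite mulrAC -powRD; last by rewrite (gt_eqF x0) implybT.
have -> : - p + (p - 1) = -1 by ring.
by rewrite powR_inv1 ?(ltW x0)// mulrC.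
Qed.

(** On ]0, 1[, an antiderivative of the energy density of [loglog_slope]. *)
Definition slope_potential (x : R) : R := (p - 1)^-1 * clipped_log x `^ (1 - p).

Lemma is_derive_slope_potential (x : R) : 0 < x < 1 ->
  is_derive x 1 slope_potential (clipped_log x `^ (- p) / x).
Proof.
move=> x01; have h1 := is_derive_clipped_log x01.
have h2 := @is_derive1_powR R (1 - p) _ (clipped_log_gt0 x).
have h3 := @is_derive1_comp _ (fun y : R => y `^ (1 - p)) clipped_log x _ _ h2 h1.
have h := is_deriveM (is_derive_cst ((p - 1)^-1 : R) x 1) h3.
apply: (is_derive1_eq h); rewrite /GRing.scale/= mulr0 addr0.
have -> : 1 - p - 1 = - p by ring.
have x0 : x != 0 by case/andP: x01 => x0 _; rewrite gt_eqF.
by field; rewrite x0 subr_eq0 gt_eqF.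
Qed.

Lemma continuous_slope_potential x : 0 < x -> {for x, continuous slope_potential}.
Proof.
move=> x0; apply: cvgM; first exact: cvg_cst.
apply: (@continuous_comp _ _ _ clipped_log (fun y : R => y `^ (1 - p))).
  exact: continuous_clipped_log.
apply: differentiable_continuous; apply/derivable1_diffP.
by apply: derivable_powR; rewrite in_itv/= andbT clipped_log_gt0.
Qed.

(** The antiderivative [slope_potential] is bounded near 0, as p > 1. *)
Lemma energy_loglog_deriv : (energy p half_line loglog_deriv < +oo)%E.
Proof.
have ml := half_line_continuous_measurable (half_line_continuous continuous_loglog_slope).
rewrite /energy (@integral_support R `]0, 1]); first last.
- move=> x; rewrite half_lineE => x0 /= /negP; rewrite in_itv/= x0 /= -ltNge => /ltW x1.
  by rewrite loglog_deriv_out// normr0 powR0 ?mul0r// gt_eqF.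
- by move=> x /=; rewrite in_itv/= half_lineE => /andP[].
apply: (@le_lt_trans _ _ (((p - 1)^-1)%:E)); last exact: ltry.
apply: integral_at0_le.
- apply: measurable_energy_density; exact: measurable_loglog_deriv.
- by move=> x _; exact: energy_density_ge0.
move=> c c0 c1.
have sub : `[c, 1] `<=` (half_line : set R) by exact: segment_half_line.
have cs : {within `[c, 1], continuous (fun x => clipped_log x `^ (- p) / x)}.
  apply: half_line_segment_continuous => //; apply: half_line_continuous => x x0.
  apply: cvgM; last by apply: cvgV; [rewrite gt_eqF|exact: cvg_id].
  apply: (@continuous_comp _ _ _ clipped_log (fun y : R => y `^ (- p))).
    exact: continuous_clipped_log.
  apply: differentiable_continuous; apply/derivable1_diffP.
  by apply: derivable_powR; rewrite in_itv/= andbT clipped_log_gt0.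
apply: (@le_trans _ _ (\int[mu]_(x in `[c, 1%R]) (clipped_log x `^ (- p) / x)%:E)%E).
  apply: lebesgue_ge0_le_integral => //.
  - by move=> x _; exact: energy_density_ge0.
  - by apply: measurable_energy_density; apply: measurable_sub_half_line => //; exact: measurable_loglog_deriv.
  - exact: subspace_continuous_measurable_fun.
  move=> x /sub; rewrite half_lineE => x0; rewrite -loglog_slope_energy_density//.
  rewrite ler_wpM2r ?powR_ge0//; apply: ge0_ler_powR; rewrite ?nnegrE ?(ltW p0)//.
  exact: norm_loglog_deriv_le.
rewrite (@continuous_FTC2 _ _ slope_potential)//.
- rewrite -EFinB lee_fin /slope_potential.
  rewrite (_ : clipped_log 1 = 1); last by rewrite clipped_logE// ln1 subr0.
  rewrite powR1 mulr1 gerBl mulr_ge0 ?powR_ge0// invr_ge0.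
  by rewrite subr_ge0 ltW.
- split.
  + move=> x; rewrite in_itv/= => /andP[cx x1].
    by have [] := @is_derive_slope_potential x; first by rewrite x1 (lt_trans c0).
  + by apply: cvg_at_right_filter; exact: continuous_slope_potential.
  + by apply: cvg_at_left_filter; exact: continuous_slope_potential.
- move=> x; rewrite in_itv/= => /andP[cx x1]; rewrite derive1E.
  by have [] := @is_derive_slope_potential x; first by rewrite x1 (lt_trans c0).
Qed.

End fixed_exponent.

End loglog.

(** * The function spaces *)

Section spaces.
Context {R : realType}.
Local Notation mu := (@lebesgue_measure R).
Implicit Types f u v w : R -> R.

Section fixed_exponent.
Variables (p : R) (hp : 1 < p).
Let p0 : 0 < p. Proof. exact: lt_trans hp. Qed.

Lemma weighted_norm_lty (w f : R -> R) : (weighted_norm p w f < +oo)%E ->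
  (\int[mu]_(t in half_line) (`|f t| `^ p * w t)%:E < +oo)%E.
Proof. by apply: lty_poweRy; rewrite invr_neq0// gt_eqF. Qed.

Lemma W1pP u : W1p p (p - 1) u ->
  [/\ {within half_line, continuous u}, locally_integrable half_line u,
      weak_derivative u (wderiv u), (energy p half_line u < +oo)%E &
      (energy p half_line (wderiv u) < +oo)%E].
Proof.
move=> [[cu lu [v uv]] nu]; split => //.
- exact: wderiv_weak_derivative uv.
- apply: weighted_norm_lty; apply: le_lt_trans nu; rewrite /W1p_norm leeDl//.
  exact: poweR_ge0.
- apply: weighted_norm_lty; apply: le_lt_trans nu; rewrite /W1p_norm leeDr//.
  exact: poweR_ge0.
Qed.

(** The chosen weak derivative and v agree almost everywhere. *)
Lemma weighted_norm_wderiv u v : {within half_line, continuous u} -> weak_derivative u v ->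
  weighted_norm p (fun t => t `^ (p - 1)) (wderiv u) =
  weighted_norm p (fun t => t `^ (p - 1)) v.
Proof.
move=> cu uv; have uw := wderiv_weak_derivative uv.
apply: weighted_norm_ae_eq.
- by apply: (@measurable_funS _ _ _ _ setT) => //; exact: measurable_powR.
- exact: locally_integrable_measurable uw.1.
- exact: locally_integrable_measurable uv.1.
- exact: weak_derivative_ae_unique cu uw uv.
Qed.

Lemma W1p_intro u v : {within half_line, continuous u} -> weak_derivative u v ->
  (energy p half_line u < +oo)%E -> (energy p half_line v < +oo)%E -> W1p p (p - 1) u.
Proof.
move=> cu uv Eu Ev; split.
  split => //; last by exists v.
  exact: half_line_continuous_locally_integrable.
rewrite /W1p_norm (weighted_norm_wderiv cu uv).
by apply: lte_add_pinfty; [exact: (poweR_lty _ Eu)|exact: (poweR_lty _ Ev)].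
Qed.

Lemma weighted_norm_le f (e : R) : 0 <= e -> (energy p half_line f <= (e `^ p)%:E)%E ->
  (weighted_norm p (fun t => t `^ (p - 1))%R f <= e%:E)%E.
Proof.
move=> e0 Ef; rewrite /weighted_norm -/(energy p half_line f).
have -> : e%:E = ((e `^ p)%:E `^ p^-1)%E.
  by rewrite poweR_EFin -powRrM mulfV ?gt_eqF// powRr1.
have E0 : (0 <= energy p half_line f)%E.
  by apply: integral_ge0 => x _; rewrite lee_fin energy_density_ge0.
apply: gt0_ler_poweR => //.
- by rewrite invr_ge0 ltW.
- by rewrite in_itv/= E0 leey.
- by rewrite in_itv/= lee_fin powR_ge0 leey.
Qed.

(** A weak derivative of the difference of u and a test function phi is the one
    of u minus the derivative of phi. *)
Lemma W1p0E : W1p0 p (p - 1) = W1p p (p - 1) :> set (R -> R).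
Proof.
apply/seteqP; split => [u []//|u Wu]; split => // e e0.
have [cu lu uv Eu Ev] := W1pP Wu.
have e4 : 0 < (e / 4) `^ p by rewrite powR_gt0// divr_gt0.
have [phi [tphi E1 E2]] := test_function_approximation hp cu uv Eu Ev e4.
exists phi => //.
have sphi : smooth phi by case: tphi.
have cphi : {within half_line, continuous phi}.
  by apply: continuous_subspaceT => x; exact: smooth_continuous.
have uvphi := weak_derivativeB lu (half_line_continuous_locally_integrable cphi) uv
  (weak_derivative_smooth sphi).
have cup : {within half_line, continuous (u \- phi)}.
  by move=> x; apply: cvgB; [exact: cu|exact: cphi].
rewrite /W1p_norm (weighted_norm_wderiv cup uvphi).
apply: (@le_lt_trans _ _ ((e / 4)%:E + (e / 4)%:E)%E).
  have e40 : 0 <= e / 4 by rewrite divr_ge0// ltW.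
  by apply: leeD; [exact: weighted_norm_le e40 E1|exact: weighted_norm_le e40 E2].
by rewrite -EFinD lte_fin; lra.
Qed.

Lemma W1p_loglog : W1p p (p - 1) (@loglog R).
Proof.
apply: (W1p_intro (half_line_continuous (@continuous_loglog R)) (@weak_derivative_loglog R)).
- exact: energy_loglog.
- exact: energy_loglog_deriv.
Qed.

Lemma Y1p_sub_W1p : Y1p p (p - 1) `<=` (W1p p (p - 1) : set (R -> R)).
Proof.
move=> u [Wu Yu]; split => //; apply: le_lt_trans Yu; rewrite /W1p_norm /Y1p_norm leeD2r//.
have [cu _ _] := Wu.
have mu_ := half_line_continuous_measurable cu.
have mH := @measurable_half_line R.
apply: gt0_ler_poweR.
- by rewrite invr_ge0 ltW.
- rewrite in_itv/= leey andbT; apply: integral_ge0 => x _.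
  by rewrite lee_fin mulr_ge0// powR_ge0.
- rewrite in_itv/= leey andbT; apply: integral_ge0 => x _.
  by rewrite lee_fin !mulr_ge0 ?powR_ge0// addr_ge0// divr_ge0// powR_ge0.
have mpow q : measurable_fun half_line (fun x : R => x `^ q).
  by apply: (@measurable_funS _ _ _ _ setT) => //; exact: measurable_powR.
have mup : measurable_fun half_line (fun x => `|u x| `^ p).
  by apply: (measurableT_comp (measurable_powR p)); exact: measurableT_comp.
apply: lebesgue_ge0_le_integral => //.
- by move=> x _; exact: energy_density_ge0.
- exact: measurable_energy_density.
- apply: measurable_funM => //; apply: measurable_funM => //.
  apply: measurable_funD; first exact: measurable_cst.
  rewrite (_ : (fun x : R => 1 / x `^ p) = (fun x => x `^ (- p))).
    exact: mpow.
  by apply/funext => x; rewrite powRN div1r.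
move=> x _; rewrite ler_wpM2l ?powR_ge0// ler_peMr ?powR_ge0//.
by rewrite lerDl divr_ge0// powR_ge0.
Qed.

(** The additional term of the norm of Y is the energy of loglog x / x.  Were it
    finite, [energy_pick] would give points s near 0 with
    (loglog s)^p <= 1/2, but loglog is at least 1 near 0. *)
Lemma loglog_notin_Y1p : ~ Y1p p (p - 1) (@loglog R).
Proof.
move=> [_ Yu].
have : (weighted_norm p (fun t => t `^ (p - 1) * (1 + 1 / t `^ p))%R (@loglog R) < +oo)%E.
  by apply: le_lt_trans Yu; rewrite /Y1p_norm leeDl// poweR_ge0.
move=> /weighted_norm_lty I.
have mH := @measurable_half_line R.
pose f (x : R) := loglog x / x.
have cl := half_line_continuous (@continuous_loglog R).
have cf : {within half_line, continuous f}.
  apply: half_line_continuous => x x0; apply: cvgM; first exact: continuous_loglog.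
  by apply: cvgV; [rewrite gt_eqF|exact: cvg_id].
have mf := half_line_continuous_measurable cf.
have mpow q : measurable_fun half_line (fun x : R => x `^ q).
  by apply: (@measurable_funS _ _ _ _ setT) => //; exact: measurable_powR.
have fE x : 0 < x -> `|f x| `^ p = `|loglog x| `^ p * x `^ (- p).
  move=> x0; rewrite /f normrM (gtr0_norm (_ : 0 < x^-1)) ?invr_gt0//.
  by rewrite powRM// ?invr_ge0 ?(ltW x0)// -(powR_inv1 (ltW x0)) -powRrM mulN1r.
have Ef : (energy p half_line f < +oo)%E.
  apply: le_lt_trans I; apply: lebesgue_ge0_le_integral => //.
  - by move=> x _; exact: energy_density_ge0.
  - exact: measurable_energy_density.
  - apply: measurable_funM.
      apply: (measurableT_comp (measurable_powR p)); apply: measurableT_comp => //.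
      exact: half_line_continuous_measurable.
    apply: measurable_funM => //.
    apply: measurable_funD; first exact: measurable_cst.
    rewrite (_ : (fun x : R => 1 / x `^ p) = (fun x => x `^ (- p))).
      exact: mpow.
    by apply/funext => x; rewrite powRN div1r.
  move=> x; rewrite half_lineE => x0; rewrite fE// -mulrA ler_wpM2l ?powR_ge0//.
  rewrite mulrC ler_wpM2l ?powR_ge0// powRN div1r lerDr//.
have q0 : 0 < 4^-1 :> R by [].
have [N N1 HN] := energy_tail q0 mf Ef.
have [c c0 Hc] := @loglog_unbounded R 1.
(* the window [a, 2a] lies below both 1/N and c *)
pose a := Num.min (N^-1) c / 4.
have m0 : 0 < Num.min (N^-1) c by rewrite lt_min c0 invr_gt0 (lt_le_trans ltr01).
have a0 : 0 < a by rewrite divr_gt0.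
have am : 2 * a < Num.min (N^-1) c by rewrite /a; lra.
have [s /andP[as_ sa] Hs] : exists2 s, a <= s <= 2 * a & `|f s| `^ p * s `^ p <= 2^-1.
  apply: energy_pick => //; rewrite (_ : 2^-1 / 2 = 4^-1); last by field.
  apply: HN => //; first exact: segment_half_line.
  move=> x /=; rewrite in_itv/= => /andP[_ xa]; left.
  by apply: le_lt_trans xa _; apply: lt_le_trans am _; rewrite ge_min lexx.
have s0 : 0 < s by exact: lt_le_trans as_.
have l1 : 1 <= loglog s.
  apply: Hc => //; apply: (le_trans sa); apply: (le_trans (ltW am)).
  by rewrite ge_min lexx orbT.
move: Hs; rewrite fE// -mulrA -powRD; last by rewrite (gt_eqF s0) implybT.
rewrite addNr powRr0 mulr1 leNgt => /negP; apply.
apply: (@lt_le_trans _ _ 1); first by rewrite invf_lt1// ltr1n.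
have -> : 1 = 1 `^ p :> R by rewrite powR1.
apply: ge0_ler_powR; rewrite ?nnegrE ?(ltW p0)//.
by rewrite ger0_norm// loglog_ge0.
Qed.

Lemma W1p_cvg_infty u : W1p p (p - 1) u -> u t @[t --> +oo] --> 0.
Proof. by move=> /W1pP[cu _ uv Eu Ev]; exact: (cvg_infty_of_energy hp cu uv Eu Ev). Qed.

Lemma W1p_BinftyE : W1p p (p - 1) = Binfty p (p - 1) :> set (R -> R).
Proof. by apply/seteqP; split=> [u Wu|u []//]; split => //; exact: W1p_cvg_infty. Qed.

Lemma W1p_AinftyE : W1p p (p - 1) = Ainfty p (p - 1) :> set (R -> R).
Proof.
apply/seteqP; split=> [u Wu|u []//]; split => //.
have tn : (n.+1%:R : R) @[n --> \oo] --> +oo.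
  apply/cvgryPge => A; have := @nbhs_infty_gtr R A; apply: filterS => m Am.
  by apply: ltW; apply: lt_trans Am _; rewrite ltr_nat.
exists (fun n => n.+1%:R); split => //.
- by move=> n; rewrite half_lineE.
- by move=> n m nm; rewrite ler_nat.
- exact: cvg_comp tn (W1p_cvg_infty Wu).
Qed.

End fixed_exponent.

End spaces.

Theorem theorem4p3 (R : realType) (p : R) (hp : 1 < p) :
  [/\ W1p0 p (p - 1) = W1p p (p - 1),
      Y1p p (p - 1) `<` W1p p (p - 1),
      ~ (forall u : R -> R, W1p p (p - 1) u ->
           exists l : R, u t @[t --> 0^'+] --> l) &
      W1p p (p - 1) = Ainfty p (p - 1) /\ Ainfty p (p - 1) = Binfty p (p - 1)].
Proof.
split.
- exact: W1p0E.
- split; first exact: Y1p_sub_W1p.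
  by move=> WY; exact: (loglog_notin_Y1p hp (WY _ (W1p_loglog hp))).
- by move=> H; exact: (loglog_no_limit (H _ (W1p_loglog hp))).
- by split; rewrite -?W1p_AinftyE// -W1p_BinftyE.
Qed.
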